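(* Let $L=\mathrm{Lie}(G)$ be the Lie algebra of a compact semisimple Lie group $G$. Then every element $x\in L$ can be written as $x=[a,b]$ for some $a,b\in L$.
   Context: All Lie groups and Lie algebras here are real and finite-dimensional. *)

(* Defs.v *)
From HB Require Import structures.
From mathcomp Require Import all_boot all_order all_algebra.
From mathcomp Require Import all_classical all_reals all_analysis.
Import numFieldNormedType.Exports.

Set Implicit Arguments.
Unset Strict Implicit.
Unset Printing Implicit Defensive.

Local Open Scope classical_set_scope.
Local Open Scope ring_scope.

(* [U] is meant to be open; then only the values of [f] on [U] matter. *)
Fixpoint Ck (R : realType) (E F : normedModType R) (k : nat)
    (U : set E) (f : E -> F) : Prop :=
  match k with
  | 0 => forall x, U x -> {for x, continuous f}
  | j.+1 => (forall x, U x -> differentiable f x) /\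
            (forall v : E, Ck j U (fun x => 'D_v f x))
  end.

Definition smooth_on (R : realType) (E F : normedModType R)
    (U : set E) (f : E -> F) : Prop := forall k, Ck k U f.

(* Total functions are used in both directions; [chart_map] is only meaningful
   on [chart_dom] and [chart_inv] only on [chart_cod]. *)
Record chart (R : realType) (n : nat) (M : topologicalType) := Chart {
  chart_dom : set M;
  chart_cod : set 'rV[R]_n;
  chart_map :> M -> 'rV[R]_n;
  chart_inv : 'rV[R]_n -> M;
  chart_dom_open : open chart_dom;
  chart_cod_open : open chart_cod;
  chart_map_cod : forall p, chart_dom p -> chart_cod (chart_map p);
  chart_inv_dom : forall u, chart_cod u -> chart_dom (chart_inv u);
  chart_mapK : forall p, chart_dom p -> chart_inv (chart_map p) = p;
  chart_invK : forall u, chart_cod u -> chart_map (chart_inv u) = u;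
  chart_map_continuous :
    forall p, chart_dom p -> {for p, continuous chart_map};
  chart_inv_continuous :
    forall u, chart_cod u -> {for u, continuous chart_inv}
}.

HB.mixin Record isTopologicalGroup G of Topological G & Group G := {
  mulg_continuous : continuous (fun gh : G * G => (gh.1 * gh.2)%g);
  invg_continuous : continuous (fun g : G => (g^-1)%g)
}.

#[short(type="topologicalGroupType")]
HB.structure Definition TopologicalGroup :=
  {G of Topological G & Group G & isTopologicalGroup G}.

HB.mixin Record isLieGroup (R : realType) (n : nat) G of TopologicalGroup G := {
  lie_hausdorff : hausdorff_space G;
  lie_second_countable : @second_countable G;
  atlas : set (chart R n G);
  atlas_cover : forall g : G, exists2 c, atlas c & chart_dom c g;
  atlas_smooth : forall c d, atlas c -> atlas d ->
    smooth_on [set u | chart_cod c u /\ chart_dom d (chart_inv c u)]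
              (fun u => d (chart_inv c u));
  mulg_smooth : forall a b c, atlas a -> atlas b -> atlas c ->
    smooth_on [set uv : 'rV[R]_n * 'rV[R]_n |
                 [/\ chart_cod a uv.1, chart_cod b uv.2 &
                     chart_dom c (chart_inv a uv.1 * chart_inv b uv.2)%g]]
              (fun uv => c (chart_inv a uv.1 * chart_inv b uv.2)%g);
  invg_smooth : forall c d, atlas c -> atlas d ->
    smooth_on [set u | chart_cod c u /\ chart_dom d (chart_inv c u)^-1%g]
              (fun u => d (chart_inv c u)^-1%g)
}.

#[short(type="lieGroupType")]
HB.structure Definition LieGroup (R : realType) (n : nat) :=
  {G of TopologicalGroup G & isLieGroup R n G}.

Section LieAlgebraOfGroup.
Context {R : realType} {n : nat} {G : lieGroupType R n}.

(* Any chart around the identity identifies the tangent space T_1 G, i.e. the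
   vector space underlying Lie(G), with R^n; all the notions below are
   expressed through such an identification. *)
Definition chart_at_1 (c : chart R n G) : Prop :=
  @atlas R n G c /\ chart_dom c 1%g.

(* The left-invariant vector field g |-> d(L_g)_1 v, read in the chart c. *)
Definition left_invariant_field (c : chart R n G) (v u : 'rV[R]_n) :
    'rV[R]_n :=
  'D_v (fun z => c (chart_inv c u * chart_inv c z)%g) (c 1%g).

(* The bracket of two vector fields on an open subset of R^n, which is the one
   characterised by [X, Y] f = X (Y f) - Y (X f). *)
Definition field_bracket (X Y : 'rV[R]_n -> 'rV[R]_n) (u : 'rV[R]_n) :
    'rV[R]_n :=
  'D_(X u) Y u - 'D_(Y u) X u.

Definition lie_bracket (c : chart R n G) (v w : 'rV[R]_n) : 'rV[R]_n :=
  field_bracket (left_invariant_field c v) (left_invariant_field c w) (c 1%g).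

End LieAlgebraOfGroup.

Section LieAlgebraNotions.
Context {K : fieldType} {V : vectType K} (br : V -> V -> V).

Definition lie_ideal (I : {vspace V}) : Prop :=
  forall x y, y \in I -> br x y \in I.

(* When [br] is bilinear this is the span of all [br x y] with x, y in I. *)
Definition derived_space (I : {vspace V}) : {vspace V} :=
  <<[seq br x y | x <- vbasis I, y <- vbasis I]>>%VS.

Definition solvable_space (I : {vspace V}) : Prop :=
  exists k : nat, iter k derived_space I = 0%VS.

Definition semisimple_bracket : Prop :=
  forall I : {vspace V}, lie_ideal I -> solvable_space I -> I = 0%VS.

End LieAlgebraNotions.

(* Main.v *)
From HB Require Import structures.
Require Import Defs.
From mathcomp Require Import all_boot all_order all_algebra.
From mathcomp Require Import all_classical all_reals all_analysis.
From mathcomp Require Import ring lra.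
Import Order.TTheory GRing.Theory Num.Theory.
Import numFieldNormedType.Exports.

(** Through the adjoint representation the compact group acts on its Lie
    algebra L as a compact group Gam of matrices, made of automorphisms of L,
    and Gam contains elements 1 + s ad z + o(s) for every z in L.  The proof
    only uses Gam and such first-order expansions; no exponential map, root
    system or Haar measure is involved.

    Inner product.  A compact matrix group fixes an inner product
    ([invariant_form]), and every ad z is skew for it.  So tr (ad z)^2 < 0
    unless ad z = 0.  In that case z is central and spans an abelian ideal,
    so z = 0 by semisimplicity.  Hence <x, y> = - tr (ad x ad y) is an
    invariant inner product ([killing_posdef]).

    Reduction.  Let a be such that ad a has maximal rank.  Its kernel t is
    then abelian ([max_rank_commute]), and as ad a is skew, its image is the
    orthogonal complement of t.  So an element of L orthogonal to t is a
    bracket [a, b], and it suffices to move a given x into the orthogonal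
    complement of t by some automorphism in Gam.

    Minimum.  On the Gam-orbit of x, let y be a point whose orthogonal
    projection h on t is shortest.  The first variation of the norm of the
    projection at y gives [h, y] = 0 ([first_variation]); the second one
    gives <[h, z], [y, z]> <= |proj_t [y, z]|^2 for all z
    ([second_variation]).  For z in the image of ad h, [y, z] is in that
    image too, hence orthogonal to t, and the right-hand side vanishes.
    This says that ad y ad h is positive semidefinite, so that
    0 <= tr (ad y ad h) = - <y, h> = - <h, h>, and h = 0
    ([minimum_orthogonal]).

    Analysis.  It remains to see that the differential of Ad at 1 is the
    bracket of left-invariant fields ([adE]).  Differentiating
    g z = (g z g^-1) g in z at 1 gives L_g = R_g o Ad g, with L_g and R_g the
    differentials at 1 of the two translations.  Differentiating in g at 1
    gives D Ad = DL - DR.  Here DL(v)(w) is the mixed second derivative of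
    the multiplication along v in the first factor and w in the second, and
    DR(v)(w) is, by the symmetry of second derivatives, the same with v and
    w exchanged; their difference is the bracket. *)

Set Implicit Arguments.
Unset Strict Implicit.
Unset Printing Implicit Defensive.

Local Open Scope classical_set_scope.
Local Open Scope ring_scope.

(** * Bilinear forms on row vectors *)

Section Forms.
Context {R : realType} {n : nat}.
Implicit Types (K M : 'M[R]_n) (x y z : 'rV[R]_n).

Definition form K x y : R := (x *m K *m y^T) 0 0.

Lemma formDl K x y z : form K (x + y) z = form K x z + form K y z.
Proof. by rewrite /form !mulmxDl mxE. Qed.

Lemma formDr K x y z : form K x (y + z) = form K x y + form K x z.
Proof. by rewrite /form linearD /= mulmxDr mxE. Qed.

Lemma formZl K a x y : form K (a *: x) y = a * form K x y.
Proof. by rewrite /form -!scalemxAl mxE. Qed.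

Lemma formZr K a x y : form K x (a *: y) = a * form K x y.
Proof. by rewrite /form linearZ /= -!scalemxAr mxE. Qed.

Lemma formNl K x y : form K (- x) y = - form K x y.
Proof. by rewrite -scaleN1r formZl mulN1r. Qed.

Lemma formNr K x y : form K x (- y) = - form K x y.
Proof. by rewrite -scaleN1r formZr mulN1r. Qed.

Lemma form0l K y : form K 0 y = 0.
Proof. by rewrite -(scale0r 0) formZl mul0r. Qed.

Lemma form0r K y : form K y 0 = 0.
Proof. by rewrite -(scale0r 0) formZr mul0r. Qed.

Lemma formC K x y : K^T = K -> form K x y = form K y x.
Proof.
by move=> KT; rewrite /form -{1}KT -mulmxA -trmx_mul -[x in LHS]trmxK -trmx_mul mxE.
Qed.

Definition posdef K : Prop := K^T = K /\ forall x, x != 0 -> 0 < form K x x.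

Lemma posdef_ge0 K x : posdef K -> 0 <= form K x x.
Proof.
case=> _ KP; have [->|/KP/ltW//] := eqVneq x 0.
by rewrite form0l.
Qed.

Lemma posdef_eq0 K x : posdef K -> form K x x = 0 -> x = 0.
Proof.
case=> _ KP fx0; apply/eqP; apply: contraT => /KP.
by rewrite fx0 ltxx.
Qed.

End Forms.

Lemma form_delta (R : realType) n (K : 'M[R]_n) i j :
  form K (delta_mx 0 i) (delta_mx 0 j) = K i j.
Proof. by rewrite /form -rowE trmx_delta -colE !mxE. Qed.

(** Gram-Schmidt as an induction on the size: the first row is used to clear
    the first column, and the remaining block (a Schur complement) is again
    positive definite. *)
Lemma posdef_orthonormal (R : realType) n (K : 'M[R]_n) :
  posdef K -> exists P : 'M[R]_n, P *m K *m P^T = 1%:M.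
Proof.
elim: n K => [|n IH] K; first by move=> _; exists 1%:M; apply/matrixP => -[].
rewrite -[n.+1]/(1 + n)%N in K *.
case; rewrite -(submxK K).
move: (ulsubmx K) (ursubmx K) (dlsubmx K) (drsubmx K) => {K} a b c d.
rewrite tr_block_mx => /eq_block_mx [aT cT bT dT] KP.
have a_gt0 : 0 < a 0 0.
  have := KP (row_mx 1%:M 0) _.
  rewrite /form mul_row_block !mul1mx !mul0mx !addr0 tr_row_mx mul_row_col trmx0.
  rewrite mulmx0 trmx1 mulmx1 addr0; apply.
  apply/negP => /eqP; rewrite -(row_mx0 R 1 1 n) => /eq_row_mx [/matrixP/(_ 0 0)].
  by rewrite !mxE eqxx => /eqP; rewrite oner_eq0.
have a_neq0 : a 0 0 != 0 by rewrite gt_eqF.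
have aE : a = (a 0 0)%:M by rewrite [LHS]mx11_scalar.
pose k := - (a 0 0)^-1 *: c.
have kK : k *m a + c = 0.
  by rewrite aE mul_mx_scalar scalerA mulrN mulfV // scaleN1r addNr.
pose d' := k *m b + d.
have [|P PP] := IH d'.
  split; first by rewrite /d' linearD /= trmx_mul /k linearZ /= dT bT cT
    -scalemxAr -scalemxAl.
  move=> x x0; have := KP (row_mx (x *m k) x) _.
  rewrite /form mul_row_block -mulmxA -mulmxDr kK mulmx0 tr_row_mx mul_row_col mul0mx.
  rewrite add0r -mulmxA -mulmxDr; apply.
  apply/negP => /eqP; rewrite -(row_mx0 R 1 1 n) => /eq_row_mx [_ x00].
  by rewrite x00 eqxx in x0.
pose s := (Num.sqrt (a 0 0))^-1.
exists (block_mx s%:M 0 (P *m k) P).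
rewrite mulmx_block !mul0mx !addr0 -!mulmxA -!mulmxDr kK mulmx0.
rewrite tr_block_mx trmx0 mulmx_block !mul0mx !mulmx0 !addr0 !add0r.
rewrite -/d' PP tr_scalar_mx (_ : s%:M *m a *m _ = 1%:M); last first.
  rewrite aE -!scalar_mxM /s mulrAC -invfM -expr2 sqr_sqrtr ?ltW//.
  by rewrite mulVf.
rewrite (_ : _ + _ = 0) -?scalar_mx_block//.
have -> : b = c^T by [].
rewrite -!mulmxA -mulmxDr -trmx_mul -{1}aT -trmx_mul -linearD /= -mulmxA.
by rewrite -mulmxDr kK mulmx0 trmx0 mulmx0.
Qed.

(** The rows of [P] form an orthonormal basis.  This is the only access to
    orthonormal bases that is needed: every later use of them is through a
    trace. *)
Lemma trace_orthonormal (R : realType) n (K : 'M[R]_n) :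
  posdef K -> exists2 P : 'M[R]_n, P \in unitmx &
    forall M, \tr M = \sum_i form K (row i P *m M) (row i P).
Proof.
move=> /posdef_orthonormal[P PK].
have [Pu _] := mulmx1_unit (etrans (mulmxA P K P^T) PK).
exists P => // M.
(* The matrix of [M] in the new basis has the same trace. *)
have <- : \tr (P *m M *m invmx P) = \tr M by rewrite mxtrace_mulC mulKmx.
have -> : invmx P = K *m P^T.
  by rewrite -[RHS](mulKmx Pu) [P *m (K *m _)]mulmxA PK mulmx1.
apply: eq_bigr => i _; rewrite /form -!row_mul mulmxA mxE [RHS]mxE.
by rewrite [RHS]mxE; apply: eq_bigr => j _; rewrite !mxE.
Qed.

Lemma trace_ge0 (R : realType) n (K M : 'M[R]_n) :
  posdef K -> (forall x, 0 <= form K (x *m M) x) -> 0 <= \tr M.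
Proof.
move=> /trace_orthonormal[P _ ->] M_ge0; apply: sumr_ge0 => i _; exact: M_ge0.
Qed.

(** In an orthonormal basis, - tr (M M) is the sum of the squared norms of the
    images of the basis vectors. *)
Lemma skew_trace (R : realType) n (K M : 'M[R]_n) : posdef K ->
  (forall x y, form K (x *m M) y = - form K x (y *m M)) ->
  M != 0 -> \tr (M *m M) < 0.
Proof.
move=> KP Msk; rewrite ltNge; apply: contraNN => trM.
have [P Pu trE] := trace_orthonormal KP.
rewrite trE in trM.
have MP i : row i P *m M = 0.
  apply: (posdef_eq0 KP).
  have : \sum_i form K (row i P *m M) (row i P *m M) = 0.
    apply/eqP; rewrite eq_le sumr_ge0 ?andbT; last by move=> ? _; exact: posdef_ge0.
    rewrite -oppr_ge0 -sumrN; apply: le_trans trM _; apply: ler_sum => j _.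
    by rewrite mulmxA Msk.
  move/eqP; rewrite psumr_eq0; last by move=> ? _; exact: posdef_ge0.
  by move=> /allP/(_ i (mem_index_enum _))/eqP.
rewrite -(mulKmx Pu M) (_ : P *m M = 0) ?mulmx0//.
by apply/row_matrixP => i; rewrite row_mul MP row0.
Qed.

(** * Limits of matrices *)

Lemma cvg_mx {R : realType} {T : Type} {F : set_system T} {FF : Filter F} m n
    (f : T -> 'M[R]_(m, n)) (l : 'M[R]_(m, n)) :
  (forall i j, (fun x => f x i j) @ F --> l i j) -> f @ F --> l.
Proof.
move=> fl A [P lP sPA]; apply: filterS sPA _ => /=.
apply: filter_forall => i; apply: filter_forall => j; exact: fl (lP i j).
Qed.

Lemma cvg_entry {R : realType} {T : Type} {F : set_system T} {FF : Filter F} m n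
    (f : T -> 'M[R]_(m, n)) (l : 'M[R]_(m, n)) i j :
  f @ F --> l -> (fun x => f x i j) @ F --> l i j.
Proof.
move=> fl; apply: (@cvg_comp _ _ _ f (fun M : 'M[R]_(m, n) => M i j) _ _ _ fl).
exact: coord_continuous.
Qed.

Lemma cvg_sumr {R : realType} {T : Type} {F : set_system T} {FF : Filter F}
    (I : finType) (f : I -> T -> R) (l : I -> R) :
  (forall i, f i @ F --> l i) -> (fun x => \sum_i f i x) @ F --> \sum_i l i.
Proof.
by move=> fl; apply: cvg_big => [|i _]; [exact: add_continuous|exact: fl].
Qed.

Section CvgMatrix.
Context {R : realType} {T : Type} {F : set_system T} {FF : Filter F}.

Lemma cvg_mulmx m n p (f : T -> 'M[R]_(m, n)) (g : T -> 'M[R]_(n, p))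
    (a : 'M[R]_(m, n)) (b : 'M[R]_(n, p)) :
  f @ F --> a -> g @ F --> b -> (fun x => f x *m g x) @ F --> a *m b.
Proof.
move=> fa gb; apply: cvg_mx => i j.
rewrite mxE; under eq_fun do rewrite mxE.
apply: cvg_sumr => k; apply: cvgM; exact: cvg_entry.
Qed.

Lemma cvg_trmx m n (f : T -> 'M[R]_(m, n)) (a : 'M[R]_(m, n)) :
  f @ F --> a -> (fun x => (f x)^T) @ F --> a^T.
Proof.
move=> fa; apply: cvg_mx => i j.
by rewrite mxE; under eq_fun do rewrite mxE; exact: cvg_entry.
Qed.

Lemma cvg_form n (f : T -> 'M[R]_n) (x y : T -> 'rV[R]_n)
    (a : 'M[R]_n) (b c : 'rV[R]_n) :
  f @ F --> a -> x @ F --> b -> y @ F --> c ->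
  (fun t => form (f t) (x t) (y t)) @ F --> form a b c.
Proof.
move=> fa xb yc; apply: cvg_entry; apply: cvg_mulmx; last exact: cvg_trmx.
exact: cvg_mulmx.
Qed.

End CvgMatrix.

Lemma compact_mx_box (R : realType) m n (b : R) :
  compact [set M : 'M[R]_(m, n) | forall i j, M i j \in `[- b, b]].
Proof.
have := @rV_compact R (m * n) (fun=> `[- b, b]%classic) (fun=> @segment_compact R _ _).
move=> /(@continuous_compact _ _ (@vec_mx R m n) _) h.
rewrite (_ : [set _ | _] = vec_mx @` [set v : 'rV_(m * n) | forall i, v ord0 i \in `[- b, b]]).
  apply: h; apply: continuous_subspaceT => v; apply: (@cvg_mx _ _ (nbhs v) _) => i j.
  rewrite mxE; under eq_fun do rewrite mxE.
  exact: coord_continuous.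
apply/seteqP; split=> [M Mb|_ [v vb <-] i j /=]; last by rewrite mxE.
exists (mxvec M); last exact: mxvecK.
by move=> /= k; case/mxvec_indexP: k => i j; rewrite mxvecE.
Qed.

(** The square of the Euclidean norm; the parallelogram identity below is its
    strict convexity, which the sup norm on matrices does not have. *)
Definition frob (R : realType) n (M : 'M[R]_n) : R := \sum_i \sum_j M i j ^+ 2.

Lemma frob_ge0 (R : realType) n (M : 'M[R]_n) : 0 <= frob M.
Proof. by apply: sumr_ge0 => i _; apply: sumr_ge0 => j _; exact: sqr_ge0. Qed.

Lemma frob_entry (R : realType) n (M : 'M[R]_n) i j : M i j ^+ 2 <= frob M.
Proof.
rewrite /frob (bigD1 i)//= (bigD1 j)//= -addrA lerDl addr_ge0//.
  by apply: sumr_ge0 => k _; exact: sqr_ge0.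
by apply: sumr_ge0 => k _; apply: sumr_ge0 => l _; exact: sqr_ge0.
Qed.

Lemma frob_eq0 (R : realType) n (M : 'M[R]_n) : frob M = 0 -> M = 0.
Proof.
move=> M0; apply/matrixP => i j; rewrite mxE; apply/eqP.
by rewrite -(sqrf_eq0 (M i j)) eq_le sqr_ge0 andbT -M0 frob_entry.
Qed.

Lemma frob_parallelogram (R : realType) n (M N : 'M[R]_n) :
  frob (2^-1 *: (M + N)) + frob (2^-1 *: (M - N)) = 2^-1 * (frob M + frob N).
Proof.
rewrite /frob -!big_split /= mulr_sumr; apply: eq_bigr => i _.
rewrite -!big_split /= mulr_sumr; apply: eq_bigr => j _.
by rewrite !mxE; field.
Qed.

Lemma cvg_frob (R : realType) (T : Type) (F : set_system T) (FF : Filter F) n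
    (f : T -> 'M[R]_n) (a : 'M[R]_n) :
  f @ F --> a -> (fun t => frob (f t)) @ F --> frob a.
Proof.
move=> fa; apply: cvg_sumr => i; apply: cvg_sumr => j.
under eq_fun do rewrite expr2; rewrite expr2.
by apply: cvgM; exact: cvg_entry.
Qed.

Lemma cvg_linear_mx (R : realType) (T : Type) (F : set_system T) (FF : Filter F)
    m p q (L : {linear 'rV[R]_m -> 'M[R]_(p, q)}) (f : T -> 'rV[R]_m) (l : 'rV[R]_m) :
  f @ F --> l -> (fun t => L (f t)) @ F --> L l.
Proof.
move=> fl; apply: cvg_mx => i j.
have LE x : L x i j = \sum_k x 0 k * L (delta_mx 0 k) i j.
  rewrite {1}(row_sum_delta x) linear_sum summxE; apply: eq_bigr => k _.
  by rewrite linearZ mxE.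
rewrite LE; under eq_fun do rewrite LE.
apply: cvg_sumr => k; apply: cvgM; last exact: cvg_cst.
exact: cvg_entry.
Qed.

Lemma closed_setle (R : realType) (T : topologicalType) (f g : T -> R) :
  continuous f -> continuous g -> closed [set t | f t <= g t].
Proof.
move=> cf cg.
rewrite (_ : [set _ | _] = (fun t => f t - g t) @^-1` [set x | x <= 0]); last first.
  by apply/seteqP; split => t /=; rewrite subr_le0.
apply: (continuous_closedP _).1 (@closed_le _ _).
by move=> t; apply: cvgB; [exact: cf|exact: cg].
Qed.

(** * Differential calculus *)

Section Calculus.
Context {R : realType} {V W : normedModType R}.

(** Differentiability is a local property: this is the case of the zero
    function, from which the general one follows by subtraction. *)
Lemma is_diff_near0 (f : V -> W) x : (\forall y \near x, f y = 0) -> is_diff x f 0.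
Proof.
move=> f0.
have fx0 : f x = 0 by exact: nbhs_singleton f0.
have fo : f \o shift x = cst (f x) + (\0 : {linear V -> W}) +o_ 0 id.
  apply/eqaddoP => _/posnumP[eps]; near=> h.
  rewrite !fctE /= fx0 addr0 subr0.
  rewrite (_ : f (h + x) = 0) ?normr0 ?mulr_ge0//.
  near: h.
  have := f0; rewrite (near_shift 0) subr0; exact.
have c0 : continuous (\0 : {linear V -> W}) by move=> y; exact: cst_continuous.
have d0 := diff_unique c0 fo.
by split => //; apply/diff_locallyP; rewrite d0.
Unshelve. all: by end_near. Qed.

Lemma near_eq_differentiable (f g : V -> W) x : (\forall y \near x, f y = g y) ->
  differentiable f x -> differentiable g x.
Proof.
move=> fg df; have -> : g = f + (g - f) by rewrite addrC subrK.
apply: differentiableD; first exact: df.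
suff : is_diff x (g - f) 0 by case.
by apply: is_diff_near0; apply: filterS fg => y fgy; rewrite !fctE fgy subrr.
Qed.

Lemma derive_linear (f : V -> W) x a u v : differentiable f x ->
  'D_(a *: u + v) f x = a *: 'D_u f x + 'D_v f x.
Proof. by move=> df; rewrite !deriveE// linearP. Qed.

End Calculus.

Lemma derive_comp (R : realType) (U V W : normedModType R) (f : U -> V) (g : V -> W)
    x v : differentiable f x -> differentiable g (f x) ->
  'D_v (fun y => g (f y)) x = 'D_('D_v f x) g (f x).
Proof.
move=> df dg; have dgf : differentiable (g \o f) x by exact: differentiable_comp.
transitivity ('d (g \o f) x v); first exact: deriveE.
by rewrite diff_comp// (deriveE _ dg) (deriveE _ df).
Qed.

Section Partial.
Context {R : realType} {U V W : normedModType R} (F : U * V -> W).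

Lemma differentiable_slice2 u z : differentiable F (u, z) ->
  differentiable (fun y => F (u, y)) z.
Proof.
move=> dF; exact: (@differentiable_comp _ _ _ _ (fun y => (u, y)) F).
Qed.

Lemma differentiable_slice1 u z : differentiable F (u, z) ->
  differentiable (fun y => F (y, z)) u.
Proof.
move=> dF; exact: (@differentiable_comp _ _ _ _ (fun y => (y, z)) F).
Qed.

Lemma derive_slice2 u z v : differentiable F (u, z) ->
  'D_v (fun y => F (u, y)) z = 'D_(0, v) F (u, z).
Proof.
move=> dF; have dp : differentiable (fun y : V => (u, y)) z.
  exact: differentiable_pair.
rewrite (derive_comp v dp dF); congr ('D_ _ F _).
by rewrite deriveE// diff_pair// diff_cst diff_val.
Qed.

Lemma derive_slice1 u z v : differentiable F (u, z) ->
  'D_v (fun y => F (y, z)) u = 'D_(v, 0) F (u, z).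
Proof.
move=> dF; have dp : differentiable (fun y : U => (y, z)) u.
  exact: differentiable_pair.
rewrite (derive_comp v dp dF); congr ('D_ _ F _).
by rewrite deriveE// diff_pair// diff_cst diff_val.
Qed.

End Partial.

Section Schwarz.
Context {R : realType} {V : normedModType R}.

Definition second_difference (F : V -> R) (p a b : V) (s : R) : R :=
  F (p + s *: a + s *: b) - F (p + s *: a) - (F (p + s *: b) - F p).

Lemma derive_line (F : V -> R) p a t : differentiable F (p + t *: a) ->
  is_derive t (1 : R) (fun t : R => F (p + t *: a)) ('D_a F (p + t *: a)).
Proof.
move=> dF; have dv : derivable F (p + t *: a) a by exact: diff_derivable.
have E : (fun h : R => h^-1 *: (((fun t : R => F (p + t *: a)) \o shift t) (h *: (1 : R)) - F (p + t *: a)))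
   = (fun h : R => h^-1 *: ((F \o shift (p + t *: a)) (h *: a) - F (p + t *: a))).
  apply/funext => h /=; congr (_ *: (F _ - _)).
  by rewrite [h%:A]mulr1 scalerDl addrCA addrC.
by split; [rewrite /derivable E|rewrite /derive E].
Qed.

(** The mean value theorem in the direction [a] turns the second difference
    into s times an increment of ['D_a F], and the differentiability of that
    function at [p] evaluates the increment up to o(s). *)
Lemma second_difference_cvg (F : V -> R) p a b :
  (\forall q \near p, differentiable F q) -> differentiable ('D_a F) p ->
  (s ^+ 2)^-1 * second_difference F p a b s @[s --> 0^'+] --> 'D_b ('D_a F) p.
Proof.
move=> dF dDF; rewrite deriveE//; set L := 'd _ _.
apply/cvgrPdist_le => eps eps0.
(* The two remainders are taken at vectors of norm at most s (|a| + |b|);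
   adding 1 makes the constant nonzero. *)
pose k := 2 * (`|a| + `|b|) + 1.
have k0 : 0 < k by rewrite ltr_wpDl// mulr_ge0// addr_ge0.
have e0 : 0 < eps / k by rewrite divr_gt0.
have DE := diff_locallyx dDF; rewrite -/L in DE.
set r := 'o _ in DE.
have [d d0 dP] : exists2 d : R, 0 < d & forall h : V, `|h| < d ->
    differentiable F (h + p) /\ `|r h| <= eps / k * `|h|.
  have r_o := littleoP [littleo of r] e0.
  have dF0 : \forall h \near (0 : V), differentiable F (h + p).
    by move: dF; rewrite (near_shift 0) subr0.
  have /nbhs_ballP[d d0 dP] : \forall h \near (0 : V),
      differentiable F (h + p) /\ `|r h| <= eps / k * `|h|.
    exact: filterI dF0 r_o.
  exists d => // h hd; apply: dP.
  by rewrite -ball_normE /= sub0r normrN.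
near=> s.
have s0 : 0 < s by near: s; exact: nbhs_right_gt.
have sd : s * k < d.
  rewrite -ltr_pdivlMr//; near: s; apply: nbhs_right_lt; exact: divr_gt0.
have small t c : 0 <= t <= s -> 0 <= c <= s -> `|t *: a + c *: b| <= s * (`|a| + `|b|).
  move=> /andP[t_ge0 ts] /andP[c_ge0 cs]; apply: le_trans (ler_normD _ _) _.
  by rewrite mulrDr !normrZ !ger0_norm// lerD// ler_wpM2r.
have small' t c : 0 <= t <= s -> 0 <= c <= s -> `|t *: a + c *: b| < d.
  move=> ts cs; apply: le_lt_trans (small _ _ ts cs) _; apply: le_lt_trans sd.
  rewrite ler_pM2l// /k; have := normr_ge0 a; have := normr_ge0 b; lra.
have dline t c : 0 <= t <= s -> 0 <= c <= s -> differentiable F (p + c *: b + t *: a).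
  move=> ts cs; have [] := dP _ (small' _ _ ts cs).
  by rewrite addrC [t *: a + _]addrC addrA.
pose phi (t : R) := F (p + s *: b + t *: a) - F (p + 0 *: b + t *: a).
pose dphi (t : R) := 'D_a F (p + s *: b + t *: a) - 'D_a F (p + 0 *: b + t *: a).
have phiP t : 0 <= t <= s -> is_derive t (1 : R) phi (dphi t).
  move=> ts.
  have ds : 0 <= s <= s by rewrite lexx ltW.
  have d00 : 0 <= (0 : R) <= s by rewrite lexx ltW.
  have := derive_line (dline _ _ ts ds); have := derive_line (dline _ _ ts d00).
  by move=> h1 h2; exact: is_deriveB.
have [t] : exists2 t, t \in `[0, s] & phi s - phi 0 = dphi t * (s - 0).
  apply: MVT_segment; first exact: ltW.
    by move=> t; rewrite in_itv /= => /andP[t0 ts]; apply: phiP; rewrite !ltW.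
  apply: derivable_within_continuous => t; rewrite in_itv /= => ts.
  by have [] := phiP t ts.
rewrite in_itv /= => ts; rewrite subr0 => phiE.
have sdE : second_difference F p a b s = dphi t * s.
  rewrite -phiE /phi /second_difference !scale0r !addr0 [p + s *: a + _]addrAC.
  by ring.
have rE : dphi t = s * L b + (r (t *: a + s *: b) - r (t *: a + 0 *: b)).
  rewrite /dphi.
  have e1 c : p + c *: b + t *: a = (t *: a + c *: b) + p.
    by rewrite addrAC [in RHS]addrC addrA.
  have LE c : L (t *: a + c *: b) = t * L a + c * L b by rewrite linearD !linearZ.
  by rewrite !e1 !DE !LE; ring.
have ds : 0 <= s <= s by rewrite lexx ltW.
have d00 : 0 <= (0 : R) <= s by rewrite lexx ltW.
have bound c : 0 <= c <= s -> `|r (t *: a + c *: b)| <= eps / k * (s * (`|a| + `|b|)).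
  move=> cs; have [_ rh] := dP _ (small' _ _ ts cs).
  by apply: le_trans rh _; rewrite ler_wpM2l ?(ltW e0)//; exact: small.
have s_neq0 : s != 0 by rewrite gt_eqF.
rewrite sdE rE (_ : _ - _ = - (s^-1 * (r (t *: a + s *: b) - r (t *: a + 0 *: b)))); last first.
  by field.
rewrite normrN normrM gtr0_norm ?invr_gt0// ler_pdivrMl//.
apply: le_trans (ler_normB _ _) _.
apply: le_trans (lerD (bound _ ds) (bound _ d00)) _.
rewrite (_ : _ + _ = s * (eps * (2 * (`|a| + `|b|) / k))); last by ring.
rewrite ler_pM2l// ler_piMr ?(ltW eps0)// ler_pdivrMr// mul1r /k; lra.
Unshelve. all: by end_near. Qed.

(** Both sides are limits of the same quotient, since the second difference is
    symmetric in [a] and [b]. *)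
Lemma derive_schwarz (F : V -> R) p a b :
  (\forall q \near p, differentiable F q) ->
  differentiable ('D_a F) p -> differentiable ('D_b F) p ->
  'D_b ('D_a F) p = 'D_a ('D_b F) p.
Proof.
move=> dF dA dB; have ha := @second_difference_cvg F p a b dF dA.
have hb := @second_difference_cvg F p b a dF dB.
apply: (@cvg_unique _ _ _ _ _ _ ha); first exact: norm_hausdorff.
rewrite (_ : (fun s => _) = (fun s => (s ^+ 2)^-1 * second_difference F p b a s))//.
apply/funext => s; congr (_ * _); rewrite /second_difference.
by rewrite [p + s *: a + _]addrAC; ring.
Qed.

End Schwarz.

Lemma differentiable_entry (R : realType) (V : normedModType R) m n
    (f : V -> 'M[R]_(m, n)) x i j :
  differentiable f x -> differentiable (fun y => f y i j) x.
Proof.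
move=> df; apply: (@differentiable_comp _ _ _ _ f (fun M : 'M[R]_(m, n) => M i j)) => //.
exact: differentiable_coord.
Qed.

Lemma derive_entry (R : realType) (V : normedModType R) m n
    (f : V -> 'M[R]_(m, n)) x v i j :
  derivable f x v -> 'D_v f x i j = 'D_v (fun y => f y i j) x.
Proof. by move=> df; rewrite derive_mx// mxE. Qed.

Lemma derive_schwarz_mx (R : realType) (V : normedModType R) m n
    (F : V -> 'M[R]_(m, n)) p a b :
  (\forall q \near p, differentiable F q) ->
  differentiable ('D_a F) p -> differentiable ('D_b F) p ->
  'D_b ('D_a F) p = 'D_a ('D_b F) p.
Proof.
move=> dF dA dB; apply/matrixP => i j.
have dab : derivable ('D_a F) p b by exact: diff_derivable.
have dba : derivable ('D_b F) p a by exact: diff_derivable.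
apply: (etrans (derive_entry i j dab)); apply/esym.
apply: (etrans (derive_entry i j dba)); apply/esym.
have eqD v : \forall q \near p, 'D_v F q i j = 'D_v (fun y => F y i j) q.
  apply: filterS dF => q dFq.
  have dv : derivable F q v by exact: diff_derivable.
  exact: derive_entry.
apply: (etrans (near_eq_derive _ (eqD a))); apply/esym.
apply: (etrans (near_eq_derive _ (eqD b))); apply/esym.
apply: derive_schwarz.
- by apply: filterS dF => q; exact: differentiable_entry.
- by apply: near_eq_differentiable (eqD a) _; exact: differentiable_entry.
- by apply: near_eq_differentiable (eqD b) _; exact: differentiable_entry.
Qed.

Section MatrixProduct.
Context {R : realType} {V : normedModType R} {m n p : nat}.
Variables (M : V -> 'M[R]_(m, n)) (N : V -> 'M[R]_(n, p)) (x v : V).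
Hypothesis dM : derivable M x v.
Hypothesis dN : derivable N x v.

Lemma derive_mulmx :
  'D_v (fun y => M y *m N y) x = 'D_v M x *m N x + M x *m 'D_v N x.
Proof.
have dMi i j : derivable (fun y => M y i j) x v by exact/(derivable_mxP M x v).1.
have dNi i j : derivable (fun y => N y i j) x v by exact/(derivable_mxP N x v).1.
have E i k : is_derive x v (fun y => (M y *m N y) i k)
    (\sum_j (M x i j * 'D_v (fun y => N y j k) x + N x j k * 'D_v (fun y => M y i j) x)).
  rewrite (_ : (fun y => _) = \sum_j ((fun y => M y i j) * (fun y => N y j k))); last first.
    by apply/funext => y; rewrite mxE fct_sumE.
  apply: is_derive_sum => j.
  by apply: is_deriveM; exact: derivableP.
have dMN : derivable (fun y => M y *m N y) x v.
  by apply/derivable_mxP => i k; have [] := E i k.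
apply/matrixP => i k; rewrite derive_entry//; have [_ ->] := E i k.
rewrite !mxE -big_split /=; apply: eq_bigr => j _.
by rewrite !derive_entry// addrC [N x j k * _]mulrC.
Qed.

End MatrixProduct.

Lemma derive_mulmx_l (R : realType) (V : normedModType R) m n p
    (A : 'M[R]_(m, n)) (N : V -> 'M[R]_(n, p)) x v : derivable N x v ->
  'D_v (fun y => A *m N y) x = A *m 'D_v N x.
Proof.
move=> dN; have := derive_mulmx (derivable_cst A x v) dN.
by rewrite derive_cst mul0mx add0r.
Qed.

Lemma derive_mulmx_r (R : realType) (V : normedModType R) m n p
    (M : V -> 'M[R]_(m, n)) (A : 'M[R]_(n, p)) x v : derivable M x v ->
  'D_v (fun y => M y *m A) x = 'D_v M x *m A.
Proof.
move=> dM; have := derive_mulmx dM (derivable_cst A x v).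
by rewrite derive_cst mulmx0 addr0.
Qed.

Lemma differentiable_prod (R : realType) (V : normedModType R) (I : Type)
    (r : seq I) (f : I -> V -> R) x :
  (forall i, differentiable (f i) x) ->
  differentiable (fun u => \prod_(i <- r) f i u) x.
Proof.
move=> df; elim: r => [|i r IH].
  rewrite (_ : (fun u => _) = cst 1); first exact: differentiable_cst.
  by apply/funext => u; rewrite big_nil.
rewrite (_ : (fun u => _) = f i \* (fun u => \prod_(i <- r) f i u)).
  exact: differentiableM.
by apply/funext => u; rewrite big_cons.
Qed.

Lemma differentiable_bigsum (R : realType) (V : normedModType R) (I : Type)
    (r : seq I) (f : I -> V -> R) x :
  (forall i, differentiable (f i) x) ->
  differentiable (fun u => \sum_(i <- r) f i u) x.
Proof.
move=> df; elim: r => [|i r IH].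
  rewrite (_ : (fun u => _) = cst 0); first exact: differentiable_cst.
  by apply/funext => u; rewrite big_nil.
rewrite (_ : (fun u => _) = f i \+ (fun u => \sum_(i <- r) f i u)).
  exact: differentiableD.
by apply/funext => u; rewrite big_cons.
Qed.

Lemma differentiable_det (R : realType) (V : normedModType R) n
    (M : V -> 'M[R]_n) x :
  (forall i j, differentiable (fun u => M u i j) x) ->
  differentiable (fun u => \det (M u)) x.
Proof.
move=> dM; rewrite /determinant; apply: differentiable_bigsum => s.
by apply: differentiableM => //; apply: differentiable_prod => i; exact: dM.
Qed.

(** Cramer's rule. *)
Lemma differentiable_invmx (R : realType) (V : normedModType R) n
    (M : V -> 'M[R]_n) x :
  (forall i j, differentiable (fun u => M u i j) x) -> M x \in unitmx ->
  (\forall u \near x, M u \in unitmx) /\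
  forall i j, differentiable (fun u => invmx (M u) i j) x.
Proof.
move=> dM Mx; have dd := differentiable_det dM.
have d0 : \det (M x) != 0 by rewrite -unitfE -unitmxE.
have nz : \forall u \near x, M u \in unitmx.
  have dc := differentiable_continuous dd.
  have h : \forall u \near x, \det (M u) != 0.
    exact: (dc _ (open_nbhs_nbhs (conj (@open_neq R 0) d0))).
  by apply: filterS h => u /= d0u; rewrite unitmxE unitfE.
split=> // i j.
have dC : differentiable (fun u => \det (row' j (col' i (M u)))) x.
  apply: differentiable_det => k l.
  rewrite (_ : (fun u => _) = fun u => M u (lift j k) (lift i l)); first exact: dM.
  by apply/funext => u; rewrite !mxE.
have : differentiable (fun u => (\det (M u))^-1 *
    ((-1) ^+ (j + i) * \det (row' j (col' i (M u))))) x.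
  apply: differentiableM; first exact: differentiableV.
  by apply: differentiableM dC; exact: differentiable_cst.
apply: near_eq_differentiable; apply: filterS nz => u Mu.
by rewrite /invmx Mu !mxE.
Qed.

Lemma differentiable_mx (R : realType) (V : normedModType R) m n
    (M : V -> 'M[R]_(m, n)) x :
  (forall i j, differentiable (fun u => M u i j) x) -> differentiable M x.
Proof.
move=> dM.
have -> : M = \sum_i \sum_j (fun u => M u i j *: delta_mx i j).
  apply/funext => u; rewrite fct_sumE {1}(matrix_sum_delta (M u)).
  by apply: eq_bigr => i _; rewrite fct_sumE.
apply: differentiable_sum => i; apply: differentiable_sum => j.
exact: differentiableZl.
Qed.

(** * Skew endomorphisms *)

Section Skew.
Context {R : realType} {n : nat} (K A : 'M[R]_n).
Hypothesis KP : posdef K.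
Hypothesis Askew : forall x y, form K (x *m A) y = - form K x (y *m A).

(** Kernel and image of a skew endomorphism are orthogonal. *)
Lemma skew_ker_im (x w : 'rV[R]_n) : x *m A = 0 -> x = w *m A -> x = 0.
Proof.
move=> xA0 xwA; apply: (posdef_eq0 KP).
by rewrite {1}xwA Askew xA0 form0r oppr0.
Qed.

Lemma skew_cap : (kermx A :&: A)%MS = 0.
Proof.
apply/eqP; rewrite -submx0; apply/rV_subP => x.
rewrite sub_capmx => /andP[/sub_kermxP xA0 /submxP[w xwA]].
by rewrite (skew_ker_im xA0 xwA) sub0mx.
Qed.

Lemma skew_sum (x : 'rV[R]_n) : (x <= kermx A + A)%MS.
Proof.
apply: submx_full; rewrite /row_full.
by rewrite (mxrank_disjoint_sum skew_cap) mxrank_ker subnK ?rank_leq_row.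
Qed.

(** As the image of [A] is the orthogonal complement of its kernel, projecting
    along the image is the orthogonal projection on the kernel. *)
Definition ker_proj : 'M[R]_n := proj_mx (kermx A) A.

Lemma ker_projA (x : 'rV[R]_n) : x *m ker_proj *m A = 0.
Proof. by apply/sub_kermxP; exact: proj_mx_sub. Qed.

Lemma ker_proj_im (x : 'rV[R]_n) : exists w, x = x *m ker_proj + w *m A.
Proof.
have /submxP[w xE] := proj_mx_compl_sub (skew_sum x).
by exists w; rewrite -xE addrC subrK.
Qed.

Lemma ker_proj_id (x : 'rV[R]_n) : x *m A = 0 -> x *m ker_proj = x.
Proof. by move=> xA; apply: proj_mx_id skew_cap _; apply/sub_kermxP. Qed.

Lemma ker_proj_form x v : v *m A = 0 -> form K (x *m ker_proj) v = form K x v.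
Proof.
move=> vA; have [w {2}->] := ker_proj_im x.
by rewrite formDl Askew vA form0r oppr0 addr0.
Qed.

Lemma skew_orth_ker (x : 'rV[R]_n) : (forall v, v *m A = 0 -> form K x v = 0) ->
  exists w, x = w *m A.
Proof.
move=> xv; have [w xE] := ker_proj_im x.
exists w; rewrite {1}xE (_ : x *m ker_proj = 0) ?add0r//.
apply: (posdef_eq0 KP); rewrite ker_proj_form ?ker_projA//.
exact/xv/ker_projA.
Qed.

Lemma ker_proj_unit : A + ker_proj \in unitmx.
Proof.
rewrite -row_free_unit -kermx_eq0 -submx0; apply/rV_subP => x /sub_kermxP.
rewrite mulmxDr => xE.
have xP0 : x *m ker_proj = 0.
  apply: (@skew_ker_im _ (- x)); first exact: ker_projA.
  by rewrite mulNmx; apply/eqP; rewrite -subr_eq0 opprK addrC xE.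
have xA : x *m A = 0 by rewrite xP0 addr0 in xE.
by rewrite -(ker_proj_id xA) xP0 sub0mx.
Qed.

(** On the image of [A], which [B] preserves, [A] is invertible, hence so is
    [A + s B] for small s; thus the kernel of [A + s B] lies in that of [A].
    By maximality of the rank the two kernels are equal, and on them [s B]
    vanishes. *)
Lemma max_rank_commute (B : 'M[R]_n) : A *m B = B *m A ->
  (forall s : R, \rank (A + s *: B)%R <= \rank A)%N ->
  forall v : 'rV[R]_n, v *m A = 0 -> v *m B = 0.
Proof.
move=> AB rk v vA.
(* Adding [ker_proj] fills the kernel, so that invertibility on the image
   becomes the nonvanishing of a determinant. *)
have [s s0 Ms] : exists2 s : R, s != 0 & A + ker_proj + s *: B \in unitmx.
  have : differentiable (fun s : R => \det (A + ker_proj + s *: B)) 0.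
    apply: differentiable_det => i j.
    rewrite (_ : (fun u => _) = cst ((A + ker_proj) i j) \+ (fun u : R => u * B i j)).
      apply: differentiableD => //; apply: differentiableM => //.
    by apply/funext => u /=; rewrite 2![in LHS]mxE [(u *: B) _ _]mxE !mxE.
  move/differentiable_continuous => cd.
  have d0 : \det (A + ker_proj + 0 *: B) != 0.
    by rewrite scale0r addr0 -unitfE -unitmxE ker_proj_unit.
  have nz : \forall s \near (0 : R), \det (A + ker_proj + s *: B) != 0.
    exact: (cd _ (open_nbhs_nbhs (conj (@open_neq R 0) d0))).
  have [s []] := filter_ex (filterI (nbhs_dnbhs nz) (nbhs_dnbhs_neq (0 : R))).
  by move=> Ms s0; exists s => //; rewrite unitmxE unitfE.
pose C : 'M[R]_n := A + s *: B.
have AC : A *m C = C *m A by rewrite mulmxDr mulmxDl -scalemxAr AB -scalemxAl.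
have kerC (z : 'rV[R]_n) : z *m C = 0 -> z *m A = 0.
  have [w ->] := ker_proj_im z; set z0 := z *m ker_proj.
  have z0A : z0 *m A = 0 by exact: ker_projA.
  rewrite mulmxDl => zC.
  have z0C : z0 *m C = 0.
    apply: (@skew_ker_im _ (- (w *m C))); first by rewrite -mulmxA -AC mulmxA z0A mul0mx.
    rewrite mulNmx -[w *m C *m A]mulmxA -AC mulmxA; apply/eqP.
    by rewrite -subr_eq0 opprK zC.
  rewrite z0C add0r in zC.
  suff -> : w *m A = 0 by rewrite addr0.
  apply/(can_inj (mulmxK Ms)).
  rewrite mul0mx addrAC mulmxDr -/C zC add0r.
  apply: (posdef_eq0 KP); rewrite ker_proj_form ?ker_projA// Askew.
  by rewrite ker_projA form0r oppr0.
have kk : (kermx C <= kermx A)%MS.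
  by apply/rV_subP => z /sub_kermxP/kerC/sub_kermxP.
have := mxrank_leqif_sup kk; rewrite !mxrank_ker => -[le_rk] /esym.
have rkC : (\rank C <= \rank A)%N := rk s.
rewrite eqn_leq le_rk leq_sub2l// => kk'.
have vC : v *m C = 0 by apply/sub_kermxP; apply: submx_trans kk'; apply/sub_kermxP.
move: vC; rewrite mulmxDr vA add0r -scalemxAr => /eqP.
by rewrite scaler_eq0 (negPf s0) => /eqP.
Qed.

End Skew.

(** * Invariant inner products *)

Section CompactGroup.
Context {R : realType} {n : nat} (Gam : set 'M[R]_n).

Record compact_group : Prop := CompactGroup {
  cg_compact : compact Gam;
  cg1 : Gam 1%:M;
  cgM : forall A B, Gam A -> Gam B -> Gam (A *m B);
  cgV : forall A, Gam A -> exists2 B, Gam B & A *m B = 1%:M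
}.

Hypothesis CG : compact_group.

Lemma cg_min (f : 'M[R]_n -> R) : continuous f ->
  exists2 A, Gam A & forall B, Gam B -> f A <= f B.
Proof.
move=> cf; have [||A /set_mem GA Amin] := @compact_EVT_min _ _ f Gam _ (cg_compact CG).
- by exists 1%:M; exact: cg1.
- exact: continuous_subspaceT.
by exists A => // B GB; apply: Amin; exact: mem_set.
Qed.

Lemma cg_max (f : 'M[R]_n -> R) : continuous f ->
  exists2 A, Gam A & forall B, Gam B -> f B <= f A.
Proof.
move=> cf; have [||A /set_mem GA Amax] := @compact_EVT_max _ _ f Gam _ (cg_compact CG).
- by exists 1%:M; exact: cg1.
- exact: continuous_subspaceT.
by exists A => // B GB; apply: Amax; exact: mem_set.
Qed.

Lemma cg_unit A : Gam A -> A \in unitmx.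
Proof. by move=> /(cgV CG)[B _ /mulmx1_unit[]]. Qed.

Lemma cg_inv A : Gam A -> Gam (invmx A).
Proof.
move=> GA; have [B GB AB] := cgV CG GA.
by rewrite -(mulKmx (cg_unit GA) B) AB mulmx1 in GB.
Qed.

Let act (A S : 'M[R]_n) := A *m S *m A^T.

Let form_act A S x : form (act A S) x x = form S (x *m A) (x *m A).
Proof. by rewrite /form /act trmx_mul !mulmxA. Qed.

Let lowerb (x : 'rV[R]_n) (r : R) := forall A, Gam A -> r <= form 1%:M (x *m A) (x *m A).

(* The epigraph of the largest norm of a translate, over the convex set: it is
   closed, so minimising its second coordinate avoids proving any continuity
   of a supremum. *)
Let E : set ('M[R]_n * R) :=
  [set p | (forall x r, lowerb x r -> r <= form p.1 x x) /\
           (forall A, Gam A -> frob (act A p.1) <= p.2)].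

(* A bound on the translates of the identity, which shows that the epigraph
   meets a compact box. *)
Let r0 := xget 0 [set r | forall A, Gam A -> frob (act A 1%:M) <= r].

Let act_continuous (S : 'M[R]_n) : continuous (act ^~ S).
Proof.
move=> A; apply: (cvg_mulmx (F := nbhs A)); last exact: (cvg_trmx (F := nbhs A)).
by apply: (cvg_mulmx (F := nbhs A)) => //; exact: cvg_cst.
Qed.

Let E_1 : E (1%:M, r0).
Proof.
split=> [x r /(_ _ (cg1 CG))|]; first by rewrite mulmx1.
rewrite /= /r0; case: xgetP => [r _ rP //|noub A GA].
have cf : continuous (fun A => frob (act A 1%:M)).
  by move=> B; apply: (cvg_frob (F := nbhs B)); exact: act_continuous.
have [B _ Bmax] := cg_max cf.
by exfalso; apply: (noub (frob (act B 1%:M))).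
Qed.

Let E_closed : closed E.
Proof.
have -> : E = (\bigcap_(xr in [set xr | lowerb xr.1 xr.2]) [set p | xr.2 <= form p.1 xr.1 xr.1])
    `&` (\bigcap_(A in Gam) [set p | frob (act A p.1) <= p.2]).
  apply/seteqP; split=> [p [p1 p2]|p [p1 p2]]; split.
  - by move=> -[x r] /= xr; exact: p1.
  - by move=> A /= GA; exact: p2.
  - by move=> x r xr; exact: (p1 (x, r) xr).
  - by move=> A GA; exact: (p2 A GA).
apply: closedI; apply: closed_bigI.
  move=> xr _; apply: closed_setle; first exact: cst_continuous.
  move=> p; apply: (cvg_form (F := nbhs p)); [exact: cvg_fst|exact: cvg_cst|exact: cvg_cst].
move=> A _; apply: closed_setle; last by move=> p; exact: cvg_snd.
move=> p; apply: (cvg_frob (F := nbhs p)); apply: (cvg_mulmx (F := nbhs p)); last exact: cvg_cst.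
apply: (cvg_mulmx (F := nbhs p)); [exact: cvg_cst|exact: cvg_fst].
Qed.

Let E_min : exists2 p, E p & forall q, E q -> p.2 <= q.2.
Proof.
pose B := [set S : 'M[R]_n | forall i j, S i j \in `[- (r0 + 1), r0 + 1]] `*`
          `[0, r0]%classic.
have BE : compact (B `&` E).
  by apply: compact_closedI E_closed; apply: compact_setX;
    [exact: compact_mx_box|exact: segment_compact].
have E2 p : E p -> frob p.1 <= p.2.
  by case=> _ /(_ _ (cg1 CG)); rewrite /act mul1mx trmx1 mulmx1.
have EB p : E p -> p.2 <= r0 -> B p.
  move=> Ep pr; have pr0 := le_trans (E2 _ Ep) pr.
  split=> [i j|]; last first.
    by rewrite /= in_itv /= pr andbT (le_trans (frob_ge0 _) (E2 _ Ep)).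
  have r0_ge0 : 0 <= r0 by exact: le_trans (frob_ge0 _) pr0.
  (* t^2 <= r0 implies |t| <= r0 + 1. *)
  rewrite in_itv /= -ler_norml -(@ler_pXn2r _ 2)// ?nnegrE ?addr_ge0//.
  rewrite real_normK ?num_real//; apply: le_trans (frob_entry _ _ _) _.
  by apply: le_trans pr0 _; nra.
have [||p /set_mem[_ Ep] pmin] := @compact_EVT_min _ _ snd _ _ BE.
- by exists (1%:M, r0); split; [exact: EB|exact: E_1].
- by apply: continuous_subspaceT => p; exact: cvg_snd.
exists p => // q Eq.
have [qr|/ltW rq] := leP q.2 r0.
  by apply: pmin; apply/mem_set; split => //; exact: EB.
apply: le_trans rq; apply: (pmin (1%:M, r0)); apply/mem_set.
by split; [exact: EB|exact: E_1].
Qed.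

(** Among the matrices S with r <= x S x^T whenever r bounds |x A|^2 below for
    all A in Gam, take one minimising the largest squared Frobenius norm of
    its translates A S A^T.  Both the set and the function to minimise are convex
    and Gam-invariant, and the function is strictly convex, so the minimiser
    is unique, hence invariant.  The defining inequalities, with r the minimum
    of |x A|^2, make it positive definite. *)
Lemma invariant_form : exists2 S : 'M[R]_n, posdef S &
  forall A, Gam A -> A *m S *m A^T = S.
Proof.
have [[S r] [/= SC Sr] Smin] := E_min.
have Sinv A : Gam A -> act A S = S.
  move=> GA; apply/eqP; rewrite -subr_eq0; apply/eqP.
  (* The midpoint of S and S' would do better than S if they were distinct. *)
  set S' := act A S; pose D := 2^-1 *: (S - S').
  suff : D = 0.
    move/eqP; rewrite scaler_eq0 invr_eq0 pnatr_eq0 /= subr_eq0 => /eqP ->.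
    by rewrite subrr.
  have cf : continuous (fun B => frob (act B D)).
    by move=> B; apply: (cvg_frob (F := nbhs B)); exact: act_continuous.
  have [B GB Bmin] := cg_min cf.
  suff : frob (act B D) <= 0.
    move=> fB0; have /frob_eq0 : frob (act B D) = 0 by apply/eqP; rewrite eq_le fB0 frob_ge0.
    move/(congr1 (fun M => invmx B *m M *m (invmx B)^T)).
    rewrite /act mulmx0 mul0mx !mulmxA mulVmx ?cg_unit// mul1mx.
    by rewrite -mulmxA -trmx_mul mulVmx ?cg_unit// trmx1 mulmx1.
  have := Smin (2^-1 *: (S + S'), r - frob (act B D)).
  rewrite /= lerBrDr gerDl; apply; split => /= [x t xt|C GC].
    have fE : form (2^-1 *: (S + S')) x x = 2^-1 * (form S x x + form S' x x).
      by rewrite /form -scalemxAr -scalemxAl mulmxDr mulmxDl !mxE.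
    rewrite fE form_act.
    have := SC x t xt; have := SC (x *m A) t _.
    rewrite -/(form _ _ _) => /(_ _)/[swap].
    have xAt : lowerb (x *m A) t.
      by move=> C GC; rewrite -mulmxA; apply: xt; exact: cgM.
    move=> h1 /(_ xAt) h2; lra.
  have actZD s a b : act C (s *: (a + b)) = s *: (act C a + act C b).
    by rewrite /act -scalemxAr -scalemxAl mulmxDr mulmxDl.
  have actN a : act C (- a) = - act C a by rewrite /act mulmxN mulNmx.
  have := frob_parallelogram (act C S) (act C S').
  rewrite -actN -!actZD -/D.
  have := Bmin _ GC; have := Sr _ GC; have := Sr _ (cgM CG GC GA).
  rewrite (_ : act (C *m A) S = act C S'); last first.
    by rewrite /act /S' /act trmx_mul !mulmxA.
  lra.
(* The minimiser was not required to be symmetric. *)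
exists (S + S^T) => [|A GA]; last first.
  rewrite mulmxDr mulmxDl; congr (_ + _); first exact: Sinv.
  by rewrite -[in RHS](Sinv A GA) /act !trmx_mul trmxK mulmxA.
split=> [|x x0]; first by rewrite linearD /= trmxK addrC.
have STx : form S^T x x = form S x x.
  transitivity ((x *m S *m x^T)^T 0 0); last by rewrite mxE.
  by rewrite !trmx_mul trmxK mulmxA.
have -> : form (S + S^T) x x = form S x x + form S^T x x.
  by rewrite /form mulmxDr mulmxDl mxE.
rewrite STx.
have cf : continuous (fun A : 'M[R]_n => form 1%:M (x *m A) (x *m A)).
  move=> A.
  have xA : x *m B @[B --> A] --> x *m A.
    by apply: (cvg_mulmx (F := nbhs A)); [exact: cvg_cst|exact: cvg_id].
  exact: (@cvg_form _ _ (nbhs A) _ _ (cst 1%:M) (mulmx x) (mulmx x) 1%:M _ _ (cvg_cst _)).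
have [A GA Amin] := cg_min cf.
have : 0 < form 1%:M (x *m A) (x *m A).
  have xA0 : x *m A != 0.
    by apply: contra_neq x0 => xA0; rewrite -(mulmxK (cg_unit GA) x) xA0 mul0mx.
  have -> : form 1%:M (x *m A) (x *m A) = \sum_i (x *m A) 0 i ^+ 2.
    by rewrite /form mulmx1 mxE; apply: eq_bigr => i _; rewrite [_^T _ _]mxE expr2.
  rewrite lt_neqAle sumr_ge0 ?andbT; last by move=> i _; exact: sqr_ge0.
  apply: contra_neq xA0 => /esym/eqP.
  rewrite psumr_eq0 => [/allP s0|i _]; last exact: sqr_ge0.
  apply/rowP => i; rewrite [RHS]mxE; apply/eqP.
  by rewrite -sqrf_eq0; apply: s0; exact: mem_index_enum.
have := SC x _ Amin.
lra.
Qed.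

End CompactGroup.

(** * Commutators from a compact group of automorphisms *)

Lemma mxtrace_sum (R : comNzRingType) n (I : finType) (F : I -> 'M[R]_n) :
  \tr (\sum_i F i) = \sum_i \tr (F i).
Proof. exact: (linear_sum (mxtrace : {linear 'M[R]_n -> R^o})). Qed.

Section Commutators.
Context {R : realType} {n : nat} (Gam : set 'M[R]_n).
Context (ad : {linear 'rV[R]_n -> 'M[R]_n}).

(** One-sided limits suffice, because [ad] is linear: - ad z is the velocity
    of another curve. *)
Definition tangent (g : R -> 'M[R]_n) (D : 'M[R]_n) : Prop :=
  (\forall s \near 0^'+, Gam (g s)) /\
  s^-1 *: (g s - 1%:M) @[s --> 0^'+] --> D.

Hypothesis CG : compact_group Gam.
Hypothesis ad_anti : forall x y, x *m ad y = - (y *m ad x).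
Hypothesis ad_conj : forall A v, Gam A -> ad v *m A = A *m ad (v *m A).
Hypothesis ad_tangent : forall v, exists g, tangent g (ad v).
Hypothesis ad_center : forall v, ad v = 0 -> v = 0.

Lemma tangent_cvg1 g D : tangent g D -> g s @[s --> 0^'+] --> (1%:M : 'M[R]_n).
Proof.
case=> _ gD.
have h : s *: (s^-1 *: (g s - 1%:M)) + 1%:M @[s --> 0^'+] --> 0 *: D + 1%:M.
  apply: cvgD; last exact: cvg_cst.
  by apply: cvgZ gD; apply: cvg_at_right_filter; exact: cvg_id.
rewrite scale0r add0r in h; apply: cvg_trans h; apply: near_eq_cvg.
near=> s; rewrite scalerA mulfV ?scale1r ?subrK//.
Unshelve. all: by end_near. Qed.

(** The Jacobi identity: the derivative of [ad_conj] along a curve with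
    velocity [ad z]. *)
Lemma ad_der v z : ad (v *m ad z) = ad v *m ad z - ad z *m ad v.
Proof.
have [g gt] := ad_tangent z; have g1 := tangent_cvg1 gt; case: gt => Gg gD.
set N := (fun s : R => s^-1 *: (g s - 1%:M)) in gD.
have h1 : ad v *m N s @[s --> 0^'+] --> ad v *m ad z.
  by apply: cvg_mulmx => //; exact: cvg_cst.
have h2 : N s *m ad (v *m g s) + ad (v *m N s) @[s --> 0^'+] -->
    ad z *m ad (v *m 1%:M) + ad (v *m ad z).
  apply: cvgD.
    by apply: cvg_mulmx => //; apply: cvg_linear_mx; apply: cvg_mulmx => //; exact: cvg_cst.
  by apply: cvg_linear_mx; apply: cvg_mulmx => //; exact: cvg_cst.
rewrite mulmx1 in h2.
suff -> : ad v *m ad z = ad z *m ad v + ad (v *m ad z) by rewrite addrC addKr.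
apply: (@cvg_unique _ _ _ _ _ _ h1); first exact: norm_hausdorff.
apply: cvg_trans h2; apply: near_eq_cvg; near=> s.
have Gs : Gam (g s) by near: s.
rewrite /N -!scalemxAl -!scalemxAr linearZ /= -scalerDr; congr (_ *: _).
rewrite !mulmxBr !mulmxBl linearB /= mulmx1 mul1mx mulmx1.
by rewrite ad_conj// addrA subrK.
Unshelve. all: by end_near. Qed.

(** The opposite of the Killing form. *)
Definition killing : 'M[R]_n :=
  \matrix_(i, j) - \tr (ad (delta_mx 0 i) *m ad (delta_mx 0 j)).

Lemma killingE x y : form killing x y = - \tr (ad x *m ad y).
Proof.
rewrite [in RHS](row_sum_delta y) (linear_sum ad) mulmx_sumr mxtrace_sum -sumrN.
rewrite /form mxE; apply: eq_bigr => j _.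
rewrite [in RHS](row_sum_delta x) (linear_sum ad) mulmx_suml mxtrace_sum -sumrN.
rewrite mxE mulr_suml; apply: eq_bigr => i _.
have adZ a v : ad (a *: v) = a *: ad v by rewrite linearZ.
by rewrite !mxE !adZ -scalemxAl -scalemxAr !mxtraceZ; ring.
Qed.

Lemma killing_sym : killing^T = killing.
Proof. by apply/matrixP => i j; rewrite !mxE mxtrace_mulC. Qed.

Lemma ad_skew x y z : form killing (x *m ad z) y = - form killing x (y *m ad z).
Proof.
rewrite !killingE !ad_der mulmxBl mulmxBr !linearB /=.
rewrite [\tr (ad z *m ad x *m ad y)]mxtrace_mulC -!mulmxA mulmxA.
have -> : \tr (ad x *m (ad y *m ad z)) = \tr (ad y *m (ad z *m ad x)).
  by rewrite mxtrace_mulC mulmxA.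
by rewrite -mulmxA; lra.
Qed.

Lemma killing_inv A x y : Gam A ->
  form killing (x *m A) (y *m A) = form killing x y.
Proof.
move=> GA; have Au := cg_unit CG GA.
have adA v : ad (v *m A) = invmx A *m ad v *m A.
  by rewrite -mulmxA ad_conj// mulKmx.
rewrite !killingE !adA; congr (- _).
rewrite mxtrace_mulC !mulmxA mulmxK// -!mulmxA mxtrace_mulC !mulmxA mulmxK//.
by rewrite mxtrace_mulC.
Qed.

(** Differentiating the invariance of the form S given by [invariant_form]
    makes [ad x] skew for S, so [skew_trace] applies. *)
Lemma killing_posdef : posdef killing.
Proof.
split=> [|x x0]; first exact: killing_sym.
have [S SP Sinv] := invariant_form CG.
rewrite killingE oppr_gt0; apply: (skew_trace SP); last first.
  by apply: contra_neq x0; exact: ad_center.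
have [g gt] := ad_tangent x; have g1 := tangent_cvg1 gt; case: gt => Gg gD.
set N := (fun s : R => s^-1 *: (g s - 1%:M)) in gD.
have h : N s *m S *m (g s)^T + S *m (N s)^T @[s --> 0^'+] -->
   ad x *m S *m 1%:M^T + S *m (ad x)^T.
  apply: cvgD.
    by apply: cvg_mulmx; [apply: cvg_mulmx => //; exact: cvg_cst|exact: cvg_trmx].
  by apply: cvg_mulmx; [exact: cvg_cst|exact: cvg_trmx].
rewrite trmx1 mulmx1 in h.
have S0 : ad x *m S + S *m (ad x)^T = 0.
  apply: (@cvg_unique _ _ _ _ _ _ h); first exact: norm_hausdorff.
  have h0 : cst 0 @ (0 : R)^'+ --> (0 : 'M[R]_n) by exact: cvg_cst.
  apply: cvg_trans h0; apply: near_eq_cvg; near=> s.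
  have Gs : Gam (g s) by near: s.
  rewrite /N linearZ /= -!scalemxAl -!scalemxAr -scalerDr linearB /= trmx1.
  by rewrite !mulmxBl mulmxBr Sinv// mulmx1 mul1mx addrA subrK subrr scaler0.
move=> u v; rewrite /form trmx_mul !mulmxA -[u *m S *m _]mulmxA.
rewrite (_ : S *m (ad x)^T = - (ad x *m S)); last first.
  by apply/eqP; rewrite -subr_eq0 opprK addrC S0.
by rewrite mulmxN mulNmx mulmxA [in RHS]mxE opprK.
Unshelve. all: by end_near. Qed.

Lemma killing_unit : killing \in unitmx.
Proof.
have [P PK] := posdef_orthonormal killing_posdef.
by have [] := mulmx1_unit PK; rewrite unitmx_mul => /andP[].
Qed.

(** The inverse is the adjoint, which is visibly continuous. *)
Lemma killing_invmx A : Gam A -> invmx A = killing *m A^T *m invmx killing.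
Proof.
move=> GA; have Au := cg_unit CG GA.
have AK : A *m killing *m A^T = killing.
  apply/matrixP => i j; rewrite -[RHS]form_delta -(killing_inv _ _ GA) -form_delta.
  by rewrite /form trmx_mul !mulmxA.
rewrite -[LHS](mulmxK killing_unit); congr (_ *m _).
by rewrite -{1}AK !mulmxA mulVmx// mul1mx.
Qed.

Lemma tangent_inv g D : tangent g D -> tangent (fun s => invmx (g s)) (- D).
Proof.
move=> gt; have g1 := tangent_cvg1 gt; case: gt => Gg gD; split.
  by near=> s; apply: (cg_inv CG); near: s.
have i1 : invmx (g s) @[s --> 0^'+] --> (1%:M : 'M[R]_n).
  have h : killing *m (g s)^T *m invmx killing @[s --> 0^'+] -->
      killing *m 1%:M^T *m invmx killing.
    apply: cvg_mulmx; last exact: cvg_cst.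
    by apply: cvg_mulmx; [exact: cvg_cst|exact: cvg_trmx].
  rewrite trmx1 mulmx1 mulmxV ?killing_unit// in h.
  apply: cvg_trans h; apply: near_eq_cvg; near=> s.
  by apply/esym/killing_invmx; near: s.
have h : - (s^-1 *: (g s - 1%:M)) *m invmx (g s) @[s --> 0^'+] --> - D *m 1%:M.
  by apply: cvg_mulmx => //; exact: cvgN.
rewrite mulmx1 in h; apply: cvg_trans h; apply: near_eq_cvg; near=> s.
have gu : g s \in unitmx by apply: (cg_unit CG); near: s.
by rewrite -scalerN opprB -scalemxAl mulmxBl mul1mx mulmxV.
Unshelve. all: by end_near. Qed.

Section Variation.
Variable a : 'rV[R]_n.
Let K := killing.
Let t (v : 'rV[R]_n) := v *m ad a = 0.
Let P := ker_proj (ad a).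
Hypothesis t_abelian : forall u v, t u -> t v -> u *m ad v = 0.
Let q (v : 'rV[R]_n) := form K (v *m P) (v *m P).
Variable y : 'rV[R]_n.
Hypothesis y_min : forall A, Gam A -> q y <= q (y *m A).
Let h := y *m P.

Let KP := killing_posdef.
(* The skewness premise of the lemmas on [ker_proj]. *)
Let Kskew z u v := ad_skew u v z.

Let Pform u v : form K (u *m P) (v *m P) = form K (u *m P) v.
Proof.
rewrite formC ?killing_sym// /P ker_proj_form//; first exact: formC killing_sym.
exact: ker_projA.
Qed.

Let q_expand u : q (y + u) = q y + 2 * form K h u + q u.
Proof.
rewrite /q mulmxDl formDl !formDr -/h.
rewrite [form K (u *m P) h]formC ?killing_sym// !Pform.
rewrite -/h; ring.
Qed.

Let qZ c u : q (c *: u) = c ^+ 2 * q u.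
Proof. by rewrite /q -scalemxAl formZl formZr mulrA expr2. Qed.

Let cvg_q (f : R -> 'rV[R]_n) (l : 'rV[R]_n) :
  f s @[s --> 0^'+] --> l -> q (f s) @[s --> 0^'+] --> q l.
Proof.
move=> fl; apply: cvg_form; first exact: cvg_cst;
  by apply: cvg_mulmx => //; exact: cvg_cst.
Qed.

(** The derivative at [y] of the squared norm of the projection, along the
    velocity [y *m ad z], is 2 <h, y ad z>; it has to be nonnegative for z
    and - z. *)
Lemma first_variation : h *m ad y = 0.
Proof.
have ge0 z : 0 <= form K h (y *m ad z).
  have [g gt] := ad_tangent z; have g1 := tangent_cvg1 gt; case: gt => Gg gD.
  set N := (fun s : R => s^-1 *: (g s - 1%:M)) in gD.
  have yN : y *m N s @[s --> 0^'+] --> y *m ad z.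
    by apply: cvg_mulmx => //; exact: cvg_cst.
  have lim : 2 * form K h (y *m N s) + s * q (y *m N s) @[s --> 0^'+] -->
     2 * form K h (y *m ad z) + 0 * q (y *m ad z).
    apply: cvgD.
      apply: cvgM; first exact: cvg_cst.
      by apply: cvg_form; [exact: cvg_cst|exact: cvg_cst|exact: yN].
    apply: cvgM; last exact: cvg_q.
    by apply: cvg_at_right_filter; exact: cvg_id.
  rewrite mul0r addr0 in lim.
  rewrite -(pmulr_rge0 _ (ltr0n R 2)) -(cvg_lim _ lim)//.
  apply: limr_ge; first by apply/cvg_ex; exists (2 * form K h (y *m ad z)).
  near=> s.
  have Gs : Gam (g s) by near: s.
  have s0 : 0 < s by near: s; exact: nbhs_right_gt.
  have := y_min Gs.
  have -> : y *m g s = y + s *: (y *m N s).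
    rewrite /N -scalemxAr scalerA mulfV ?gt_eqF// scale1r mulmxBr mulmx1.
    by rewrite addrC subrK.
  rewrite q_expand qZ formZr -addrA lerDl.
  move=> i1; rewrite -(pmulr_rge0 _ s0); apply: le_trans i1 _.
  by rewrite le_eqVlt; apply/orP; left; apply/eqP; ring.
have eq0 z : form K h (y *m ad z) = 0.
  apply/eqP; rewrite eq_le ge0 andbT -oppr_ge0 -formNr -mulmxN -linearN.
  exact: ge0.
apply: (posdef_eq0 KP); rewrite ad_skew.
by rewrite (ad_anti (h *m ad y) y) formNr eq0 !oppr0.
Unshelve. all: by end_near. Qed.

(** A curve g is only known to first order, but q (y g) + q (y g^-1) - 2 q y is
    determined to second order by that: g + g^-1 - 2 = - (g - 1) (g^-1 - 1)
    and g^-1 is the adjoint of g. *)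
Lemma second_variation z : form K (h *m ad z) (y *m ad z) <= q (y *m ad z).
Proof.
have [g gt] := ad_tangent z; have [Gg gD] := gt; have [Gg' gD'] := tangent_inv gt.
set N := (fun s : R => s^-1 *: (g s - 1%:M)) in gD.
set N' := (fun s : R => s^-1 *: (invmx (g s) - 1%:M)) in gD'.
have vN v : v *m N s @[s --> 0^'+] --> v *m ad z.
  by apply: cvg_mulmx => //; exact: cvg_cst.
have yN' : y *m N' s @[s --> 0^'+] --> y *m - ad z.
  by apply: cvg_mulmx => //; exact: cvg_cst.
have lim : (q (y *m N s) + q (y *m N' s)) - 2 * form K (h *m N s) (y *m N s) @[s --> 0^'+] -->
    (q (y *m ad z) + q (y *m - ad z)) - 2 * form K (h *m ad z) (y *m ad z).
  apply: cvgB; first by apply: cvgD; exact: cvg_q.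
  apply: cvgM; first exact: cvg_cst.
  by apply: cvg_form; [exact: cvg_cst|exact: vN|exact: vN].
have qN v : q (- v) = q v by rewrite -scaleN1r qZ sqrrN expr1n mul1r.
rewrite mulmxN qN in lim.
suff : 0 <= q (y *m ad z) + q (y *m ad z) - 2 * form K (h *m ad z) (y *m ad z) by lra.
rewrite -(cvg_lim _ lim)//.
apply: limr_ge; first by apply/cvg_ex; eexists; exact: lim.
near=> s.
have Gs : Gam (g s) by near: s.
have s0 : 0 < s by near: s; exact: nbhs_right_gt.
have gE v : v *m g s = v + s *: (v *m N s).
  rewrite /N -scalemxAr scalerA mulfV ?gt_eqF// scale1r mulmxBr mulmx1.
  by rewrite addrC subrK.
have gE' v : v *m invmx (g s) = v + s *: (v *m N' s).
  rewrite /N' -scalemxAr scalerA mulfV ?gt_eqF// scale1r mulmxBr mulmx1.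
  by rewrite addrC subrK.
have := y_min Gs; have := y_min (cg_inv CG Gs).
rewrite gE gE' !q_expand !qZ !formZr.
(* The two terms of first order add up to a term of second order. *)
have adj : form K h (y *m N' s) + form K h (y *m N s) = - (s * form K (h *m N s) (y *m N s)).
  have := killing_inv h (y *m invmx (g s)) Gs.
  rewrite mulmxKV ?(cg_unit CG)// [h *m _]gE gE' formDl formDr formZl formZr.
  have := killing_inv h y Gs.
  rewrite !gE formDl !formDr !formZl !formZr -/K.
  move=> e1 e2.
  have s_neq0 : s != 0 by rewrite gt_eqF.
  apply: (mulfI s_neq0).
  lra.
move=> i1 i2.
suff : 0 <= s ^+ 2 * (q (y *m N s) + q (y *m N' s) - 2 * form K (h *m N s) (y *m N s)).
  by rewrite pmulr_rge0// exprn_gt0.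
have := congr1 (fun r => s * r) adj.
nra.
Unshelve. all: by end_near. Qed.

(** By the two variations [ad y *m ad h] is positive semidefinite, whereas its
    trace is - <h, h>. *)
Lemma minimum_orthogonal : h = 0.
Proof.
set Y := ad y; set A := ad h.
have YA : A *m Y = Y *m A.
  by apply/eqP; rewrite -subr_eq0 -ad_der first_variation linear0.
have th : t h by exact: ker_projA.
have imA w : 0 <= form K (w *m A *m Y *m A) (w *m A).
  pose z := w *m A.
  have yz : y *m ad z = - (w *m Y *m A) by rewrite ad_anti /z -mulmxA YA mulmxA.
  have qz : q (y *m ad z) = 0.
    rewrite /q Pform yz formNr formC ?killing_sym// ad_skew.
    by rewrite t_abelian ?form0r ?oppr0//; exact: ker_projA.
  have := second_variation z; rewrite qz !(ad_anti _ z) formNl formNr opprK -/Y -/A.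
  move=> le0; rewrite -/z ad_skew oppr_ge0 formC ?killing_sym//.
(* The kernel of A contributes nothing, so the inequality on its image
   extends to the whole space. *)
have YA_ge0 x' : 0 <= form K (x' *m (Y *m A)) x'.
  have [w xE] := @ker_proj_im _ _ K A KP (fun u v => ad_skew u v h) x'.
  set x0 := x' *m _ in xE.
  have x0A : x0 *m A = 0 by exact: ker_projA.
  rewrite xE formDr mulmxDl -YA [x0 *m _]mulmxA x0A mul0mx add0r YA mulmxA.
  rewrite [X in X + _]ad_skew x0A form0r oppr0 add0r.
  exact: imA.
apply: (posdef_eq0 KP); apply/eqP; rewrite eq_le posdef_ge0// andbT.
rewrite Pform formC ?killing_sym// killingE oppr_le0 -/Y -/A.
exact: (trace_ge0 KP YA_ge0).
Qed.

End Variation.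

(** The point of the orbit of [x] given by [minimum_orthogonal] is orthogonal
    to t, hence a bracket, and Gam carries brackets to brackets.  Rows are
    vectors, so [b *m ad a] is the bracket of a and b. *)
Theorem compact_commutators (x : 'rV[R]_n) :
  exists a b : 'rV[R]_n, x = b *m ad a.
Proof.
have [a a_max] : exists a, forall b, (\rank (ad b) <= \rank (ad a))%N.
  pose p k := `[< exists a, \rank (ad a) = k >].
  have p_bound k : p k -> (k <= n)%N by move=> /asboolP[a <-]; exact: rank_leq_row.
  have p_ex : exists k, p k by exists (\rank (ad 0)); apply/asboolP; exists 0.
  case: (ex_maxnP p_ex p_bound) => k /asboolP[a ak] k_max; exists a => b.
  by rewrite ak; apply: k_max; apply/asboolP; exists b.
have KP := killing_posdef.
have t_abelian (u v : 'rV[R]_n) : u *m ad a = 0 -> v *m ad a = 0 -> u *m ad v = 0.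
  move=> ua va; apply: (max_rank_commute KP _ _ _ ua).
  - by move=> y z; exact: ad_skew.
  - by apply/eqP; rewrite -subr_eq0 -opprB -ad_der va linear0 oppr0.
  - by move=> s; rewrite -linearZ -linearD; exact: a_max.
pose P := ker_proj (ad a).
pose q (A : 'M[R]_n) := form killing (x *m A *m P) (x *m A *m P).
have [A|A GA Amin] := @cg_min _ _ _ CG q.
  have xAP : x *m B *m P @[B --> A] --> x *m A *m P.
    apply: (cvg_mulmx (F := nbhs A)); last exact: cvg_cst.
    by apply: (cvg_mulmx (F := nbhs A)); [exact: cvg_cst|exact: cvg_id].
  exact: (@cvg_form _ _ (nbhs A) _ _ (cst killing) _ _ killing _ _ (cvg_cst _) xAP xAP).
have h0 : x *m A *m P = 0.
  apply: (@minimum_orthogonal a t_abelian (x *m A)) => B GB.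
  by have := Amin _ (cgM CG GA GB); rewrite /q mulmxA.
have [|v va|b yb] := @skew_orth_ker _ _ killing (ad a) KP _ (x *m A).
- by move=> y z; exact: ad_skew.
- rewrite -(ker_proj_form KP _ _ va); last by move=> y z; exact: ad_skew.
  by rewrite -/P h0 form0l.
pose B := invmx A; have GB : Gam B by exact: cg_inv.
exists (a *m B), (b *m B).
by rewrite -mulmxA -ad_conj// mulmxA -yb mulmxK//; exact: (cg_unit CG).
Qed.

End Commutators.

(** * The adjoint representation *)

Lemma eq_mulmx_rV (R : realType) n (A B : 'M[R]_n) :
  (forall v : 'rV[R]_n, v *m A = v *m B) -> A = B.
Proof. by move=> AB; apply/row_matrixP => i; rewrite !rowE AB. Qed.

Section GroupTopology.
Context {G : topologicalGroupType}.

Lemma cvg_mulg (T : Type) (F : set_system T) (FF : Filter F) (f h : T -> G) a b :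
  f @ F --> a -> h @ F --> b -> (f t * h t)%g @[t --> F] --> (a * b)%g.
Proof.
move=> fa hb; have ab : (f t, h t) @[t --> F] --> (a, b) by exact: cvg_pair.
exact: cvg_comp ab (@mulg_continuous G (a, b)).
Qed.

End GroupTopology.

Section LieGroup.
Context {R : realType} {n : nat} {G : lieGroupType R n}.
Implicit Types (a b c d : chart R n G) (g : G).
Local Notation atl := (@atlas R n G).

Definition mul_chart a b c (uv : 'rV[R]_n * 'rV[R]_n) : 'rV[R]_n :=
  c (chart_inv a uv.1 * chart_inv b uv.2)%g.

Definition mul_dom a b c : set ('rV[R]_n * 'rV[R]_n) :=
  [set uv | [/\ chart_cod a uv.1, chart_cod b uv.2 &
                chart_dom c (chart_inv a uv.1 * chart_inv b uv.2)%g]].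

Lemma chart_inv_cvg c u : chart_cod c u -> chart_inv c z @[z --> u] --> chart_inv c u.
Proof. exact: chart_inv_continuous. Qed.

Lemma mul_dom_open a b c uv : mul_dom a b c uv ->
  \forall vw \near uv, mul_dom a b c vw.
Proof.
case: uv => u v [/= au bv cuv].
have h1 : \forall vw \near (u, v), chart_cod a vw.1.
  apply: (@cvg_fst _ _ (nbhs u) (nbhs v)).
  exact: open_nbhs_nbhs (conj (@chart_cod_open _ _ _ a) au).
have h2 : \forall vw \near (u, v), chart_cod b vw.2.
  apply: (@cvg_snd _ _ (nbhs u) (nbhs v)).
  exact: open_nbhs_nbhs (conj (@chart_cod_open _ _ _ b) bv).
have h3 : \forall vw \near (u, v), chart_dom c (chart_inv a vw.1 * chart_inv b vw.2)%g.
  have m : (chart_inv a vw.1 * chart_inv b vw.2)%g @[vw --> (u, v)] -->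
      (chart_inv a u * chart_inv b v)%g.
    apply: cvg_mulg.
      exact: (cvg_comp _ _ cvg_fst (chart_inv_cvg au)).
    exact: (cvg_comp _ _ cvg_snd (chart_inv_cvg bv)).
  apply: m; exact: open_nbhs_nbhs (conj (@chart_dom_open _ _ _ c) cuv).
by apply: filterS3 h1 h2 h3 => vw; split.
Qed.

Lemma mul_chart_diff a b c uv : atl a -> atl b -> atl c -> mul_dom a b c uv ->
  differentiable (mul_chart a b c) uv.
Proof. by move=> aa ab ac uvd; have [h _] := mulg_smooth a b c aa ab ac 1%N; exact: h. Qed.

Lemma mul_chart_diff2 a b c uv w : atl a -> atl b -> atl c -> mul_dom a b c uv ->
  differentiable ('D_w (mul_chart a b c)) uv.
Proof.
move=> aa ab ac uvd; have [_ h] := mulg_smooth a b c aa ab ac 2%N.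
by have [h1 _] := h w; exact: h1.
Qed.

Section AtIdentity.
Context (c : chart R n G) (c1 : chart_at_1 c).
Let e := c 1%g.

Let atc : atl c. Proof. by case: c1. Qed.
Let dom1 : chart_dom c 1%g. Proof. by case: c1. Qed.
Let cod_e : chart_cod c e. Proof. exact: chart_map_cod. Qed.
Let inv_e : chart_inv c e = 1%g. Proof. exact: chart_mapK. Qed.

Definition conj_chart g (z : 'rV[R]_n) := c (g * chart_inv c z * g^-1)%g.

Lemma conj_chart_e g : conj_chart g e = e.
Proof. by rewrite /conj_chart inv_e mulg1 mulgV. Qed.

Lemma conj_dom_near g : \forall z \near e, chart_dom c (g * chart_inv c z * g^-1)%g.
Proof.
have m : (g * chart_inv c z * g^-1)%g @[z --> e] --> (g * chart_inv c e * g^-1)%g.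
  apply: (cvg_mulg (F := nbhs e)); last exact: cvg_cst.
  by apply: (cvg_mulg (F := nbhs e)); [exact: cvg_cst|exact: (chart_inv_cvg cod_e)].
apply: m; apply: open_nbhs_nbhs; split; first exact: chart_dom_open.
by rewrite inv_e mulg1 mulgV.
Qed.

Lemma cod_near : \forall z \near e, chart_cod c z.
Proof. exact: open_nbhs_nbhs (conj (@chart_cod_open _ _ _ c) cod_e). Qed.

(** Conjugation is the composite of a left and a right translation, through a
    chart at [g]. *)
Lemma conj_chart_diff g : differentiable (conj_chart g) e.
Proof.
have [d atd dg] := @atlas_cover R n G g.
have [d' atd' dg'] := @atlas_cover R n G g^-1%g.
have h1 : differentiable (fun z => mul_chart d c d (d g, z)) e.
  apply: differentiable_slice2; apply: mul_chart_diff => //; split => //=.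
    exact: chart_map_cod.
  by rewrite inv_e mulg1 chart_mapK.
have h1e : mul_chart d c d (d g, e) = d g.
  by rewrite /mul_chart /= inv_e mulg1 chart_mapK.
have h2 : differentiable (fun w => mul_chart d d' c (w, d' g^-1%g)) (d g).
  apply: differentiable_slice1; apply: mul_chart_diff => //; split => /=.
  - exact: chart_map_cod.
  - exact: chart_map_cod.
  - by rewrite !chart_mapK// mulgV.
rewrite -h1e in h2; have := differentiable_comp h1 h2.
apply: near_eq_differentiable.
have : \forall z \near e, chart_dom d (g * chart_inv c z)%g.
  have m : (g * chart_inv c z)%g @[z --> e] --> (g * chart_inv c e)%g.
    by apply: (cvg_mulg (F := nbhs e)); [exact: cvg_cst|exact: (chart_inv_cvg cod_e)].
  apply: m; apply: open_nbhs_nbhs; split; first exact: chart_dom_open.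
  by rewrite inv_e mulg1.
apply: filterS => z zd; rewrite /mul_chart /= !chart_mapK//.
Qed.

(** With rows as vectors, [Ad] is an antihomomorphism. *)
Definition Ad g : 'M[R]_n := jacobian (conj_chart g) e.

Lemma AdE g v : 'D_v (conj_chart g) e = v *m Ad g.
Proof. exact/deriveEjacobian/conj_chart_diff. Qed.

Lemma Ad1 : Ad 1%g = 1%:M.
Proof.
apply: eq_mulmx_rV => v; rewrite -AdE mulmx1 -[RHS](derive_id e v).
apply: near_eq_derive; apply: filterS cod_near => z cz.
by rewrite /conj_chart mul1g invg1 mulg1 chart_invK.
Qed.

Lemma AdM g h : Ad (g * h)%g = Ad h *m Ad g.
Proof.
apply: eq_mulmx_rV => v; rewrite mulmxA.
apply: (etrans (esym (AdE (g * h)%g v))); apply: (etrans _ (AdE g (v *m Ad h))).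
apply: (etrans _ (congr1 (fun w => 'D_w (conj_chart g) e) (AdE h v))).
have dg : differentiable (conj_chart g) (conj_chart h e).
  by rewrite conj_chart_e; exact: conj_chart_diff.
have := derive_comp v (conj_chart_diff h) dg.
rewrite conj_chart_e => <-.
apply: near_eq_derive; apply: filterS (conj_dom_near h) => z hz.
by rewrite /conj_chart chart_mapK// invgM !mulgA.
Qed.

Lemma AdV g : Ad g *m Ad g^-1%g = 1%:M.
Proof. by rewrite -AdM mulVg Ad1. Qed.

End AtIdentity.
End LieGroup.

Section AdDerivative.
Context {R : realType} {n : nat} {G : lieGroupType R n}.
Context (c : chart R n G) (c1 : chart_at_1 c).
Local Notation atl := (@atlas R n G).
Let e := c 1%g.

Let atc : atl c. Proof. by case: c1. Qed.
Let dom1 : chart_dom c 1%g. Proof. by case: c1. Qed.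
Let cod_e : chart_cod c e. Proof. exact: chart_map_cod. Qed.
Let inv_e : chart_inv c e = 1%g. Proof. exact: chart_mapK. Qed.

Let m := mul_chart c c c.

Let dom_l u : chart_cod c u -> mul_dom c c c (u, e).
Proof. by move=> cu; split => //=; rewrite inv_e mulg1; exact: chart_inv_dom. Qed.

Let dom_r u : chart_cod c u -> mul_dom c c c (e, u).
Proof. by move=> cu; split => //=; rewrite inv_e mul1g; exact: chart_inv_dom. Qed.

Let m_diff uv : mul_dom c c c uv -> differentiable m uv.
Proof. exact: mul_chart_diff. Qed.

Let m_diff2 uv w : mul_dom c c c uv -> differentiable ('D_w m) uv.
Proof. exact: mul_chart_diff2. Qed.

(** The differentials at the identity of the left and right translations by
    the point of coordinates [u], read in the chart. *)
Definition left_mx (u : 'rV[R]_n) : 'M[R]_n := jacobian (fun z => m (u, z)) e.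
Definition right_mx (u : 'rV[R]_n) : 'M[R]_n := jacobian (fun z => m (z, u)) e.
Definition Ad_chart (u : 'rV[R]_n) : 'M[R]_n := Ad c (chart_inv c u).

Lemma left_mxE u w : chart_cod c u -> w *m left_mx u = 'D_(0, w) m (u, e).
Proof.
move=> /dom_l/m_diff dm; rewrite -derive_slice2//.
exact/esym/deriveEjacobian/differentiable_slice2.
Qed.

Lemma right_mxE u w : chart_cod c u -> w *m right_mx u = 'D_(w, 0) m (e, u).
Proof.
move=> /dom_r/m_diff dm; rewrite -derive_slice1//.
exact/esym/deriveEjacobian/differentiable_slice1.
Qed.

(** The derivative at z = 1 of g z = (g z g^-1) g. *)
Lemma left_right_mx u : chart_cod c u -> left_mx u = Ad_chart u *m right_mx u.
Proof.
move=> cu; apply: eq_mulmx_rV => w.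
have dl := m_diff (dom_l cu); have dr := m_diff (dom_r cu).
rewrite mulmxA; apply: (etrans (left_mxE w cu)).
apply: (etrans _ (esym (right_mxE (w *m Ad_chart u) cu))).
apply: (etrans (esym (derive_slice2 w dl))); apply: (etrans _ (derive_slice1 _ dr)).
pose g := chart_inv c u.
apply: (etrans _ (congr1 (fun w => 'D_w (fun y => m (y, u)) e) (AdE c1 g w))).
have dr1 : differentiable (fun y => m (y, u)) (conj_chart c g e).
  by rewrite conj_chart_e//; exact: differentiable_slice1.
have := derive_comp w (conj_chart_diff c1 g) dr1.
rewrite (conj_chart_e c1 g) => <-.
apply: near_eq_derive; apply: filterS (conj_dom_near c1 g) => z gz.
by rewrite /m /mul_chart /conj_chart /= chart_mapK// -/g mulgVK.
Qed.

Lemma right_mx_e : right_mx e = 1%:M.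
Proof.
apply: eq_mulmx_rV => w; rewrite right_mxE// mulmx1 -[RHS](derive_id e w).
rewrite -derive_slice1; last exact: m_diff (dom_l cod_e).
apply: near_eq_derive; apply: filterS (cod_near c1) => z cz.
by rewrite /m /mul_chart /= inv_e mulg1 chart_invK.
Qed.

Lemma Ad_chart_e : Ad_chart e = 1%:M.
Proof. by rewrite /Ad_chart inv_e Ad1. Qed.

Lemma left_mx_diff i j : differentiable (fun u => left_mx u i j) e.
Proof.
have h : differentiable (fun u => ('D_(0, delta_mx 0 i) m (u, e)) 0 j) e.
  apply: differentiable_entry; apply: (@differentiable_slice1 _ _ _ _ ('D_(0, delta_mx 0 i) m)).
  exact: m_diff2 (dom_l cod_e).
apply: near_eq_differentiable h; apply: filterS (cod_near c1) => u cu.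
by rewrite -left_mxE// -rowE mxE.
Qed.

Lemma right_mx_diff i j : differentiable (fun u => right_mx u i j) e.
Proof.
have h : differentiable (fun u => ('D_(delta_mx 0 i, 0) m (e, u)) 0 j) e.
  apply: differentiable_entry; apply: (@differentiable_slice2 _ _ _ _ ('D_(delta_mx 0 i, 0) m)).
  exact: m_diff2 (dom_r cod_e).
apply: near_eq_differentiable h; apply: filterS (cod_near c1) => u cu.
by rewrite -right_mxE// -rowE mxE.
Qed.

(** By [left_right_mx], [Ad] is the quotient of two differentiable matrices
    near the identity. *)
Lemma Ad_chart_diff i j : differentiable (fun u => Ad_chart u i j) e.
Proof.
have re : right_mx e \in unitmx by rewrite right_mx_e unitmx1.
have [ru rV] := differentiable_invmx right_mx_diff re.
have h : differentiable (fun u => \sum_k left_mx u i k * invmx (right_mx u) k j) e.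
  apply: differentiable_bigsum => k; apply: differentiableM; last exact: rV.
  exact: left_mx_diff.
apply: near_eq_differentiable h; apply: filterS2 ru (cod_near c1) => u ru cu.
by rewrite -[Ad_chart u](mulmxK ru) -left_right_mx// mxE.
Qed.

Let derivable_entries (M : 'rV[R]_n -> 'M[R]_n) v :
  (forall i j, differentiable (fun u => M u i j) e) -> derivable M e v.
Proof. by move=> dM; apply/derivable_mxP => i j; exact: diff_derivable. Qed.

Definition ad (v : 'rV[R]_n) : 'M[R]_n := 'D_v Ad_chart e.

Lemma derive_left_mx v w :
  w *m 'D_v left_mx e = 'D_(v, 0) ('D_(0, w) m) (e, e).
Proof.
rewrite -derive_mulmx_l; last exact/derivable_entries/left_mx_diff.
have d2 : differentiable ('D_(0, w) m) (e, e) by exact: m_diff2 (dom_l cod_e).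
rewrite -(derive_slice1 _ d2); apply: near_eq_derive.
by apply: filterS (cod_near c1) => u cu; rewrite left_mxE.
Qed.

Lemma derive_right_mx v w :
  w *m 'D_v right_mx e = 'D_(0, v) ('D_(w, 0) m) (e, e).
Proof.
rewrite -derive_mulmx_l; last exact/derivable_entries/right_mx_diff.
have d2 : differentiable ('D_(w, 0) m) (e, e) by exact: m_diff2 (dom_l cod_e).
rewrite -(derive_slice2 _ d2); apply: near_eq_derive.
by apply: filterS (cod_near c1) => u cu; rewrite right_mxE.
Qed.

Lemma left_invariant_fieldE w u : chart_cod c u ->
  left_invariant_field c w u = 'D_(0, w) m (u, e).
Proof. by move=> cu; rewrite -derive_slice2//; exact: m_diff (dom_l cu). Qed.

Lemma left_invariant_field_e w : left_invariant_field c w e = w.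
Proof.
rewrite -[RHS](derive_id e w); apply: near_eq_derive.
by apply: filterS (cod_near c1) => z cz; rewrite inv_e mul1g chart_invK.
Qed.

Lemma derive_left_invariant_field v w :
  'D_v (left_invariant_field c w) e = 'D_(v, 0) ('D_(0, w) m) (e, e).
Proof.
rewrite -derive_left_mx -derive_mulmx_l; last exact/derivable_entries/left_mx_diff.
apply: near_eq_derive; apply: filterS (cod_near c1) => u cu.
by rewrite left_invariant_fieldE// left_mxE.
Qed.

(** The product rule in [left_right_mx], where the matrices [Ad_chart e] and
    [right_mx e] are the identity; the symmetry of second derivatives
    identifies the term from right translations. *)
Lemma adE v w : w *m ad v = lie_bracket c v w.
Proof.
have dA : derivable Ad_chart e v by exact/derivable_entries/Ad_chart_diff.
have dr : derivable right_mx e v by exact/derivable_entries/right_mx_diff.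
have E : 'D_v left_mx e = ad v + 'D_v right_mx e.
  have := derive_mulmx dA dr; rewrite right_mx_e mulmx1 Ad_chart_e mul1mx => <-.
  apply: near_eq_derive; apply: filterS (cod_near c1) => u cu.
  exact: left_right_mx.
have {}E := etrans (congr1 (mulmx w) E) (mulmxDr w (ad v) ('D_v right_mx e)).
have {}E := etrans (esym (derive_left_mx v w))
  (etrans E (congr1 (fun x => w *m ad v + x) (derive_right_mx v w))).
have S : 'D_(0, v) ('D_(w, 0) m) (e, e) = 'D_(w, 0) ('D_(0, v) m) (e, e).
  apply: derive_schwarz_mx; first last.
  - exact: m_diff2 (dom_l cod_e).
  - exact: m_diff2 (dom_l cod_e).
  - by apply: filterS (mul_dom_open (dom_l cod_e)) => uv; exact: m_diff.
have {S}E := etrans E (congr1 (fun x => w *m ad v + x) S).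
rewrite /lie_bracket /field_bracket -/e !left_invariant_field_e.
apply: (etrans _ (esym (congr2 (fun x y => x - y)
  (derive_left_invariant_field v w) (derive_left_invariant_field w v)))).
exact: (canRL (addrK _) (esym E)).
Qed.

End AdDerivative.

Section AdjointGroup.
Context {R : realType} {n : nat} {G : lieGroupType R n}.
Context (c : chart R n G) (c1 : chart_at_1 c).
Let e := c 1%g.

Definition Ad_image : set 'M[R]_n := range (Ad c).

Lemma Ad_chart_derivable v : derivable (Ad_chart c) e v.
Proof. by apply/derivable_mxP => i j; exact/diff_derivable/Ad_chart_diff. Qed.

Lemma Ad_chart_cvg : Ad_chart c u @[u --> e] --> (1%:M : 'M[R]_n).
Proof.
rewrite -(Ad_chart_e c1); apply: (cvg_mx (F := nbhs e)) => i j.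
exact: (differentiable_continuous (Ad_chart_diff c1 i j)).
Qed.

(** The group law carries continuity at 1 to every point. *)
Lemma Ad_continuous : continuous (Ad c).
Proof.
case: (c1) => _ dom1 g0.
have to1 : (g0^-1 * g)%g @[g --> g0] --> (1 : G)%g.
  rewrite -(mulVg g0); apply: (cvg_mulg (F := nbhs g0)); [exact: cvg_cst|exact: cvg_id].
have A1 : Ad c g @[g --> (1 : G)%g] --> (1%:M : 'M[R]_n).
  have h : Ad_chart c (c g) @[g --> (1 : G)%g] --> (1%:M : 'M[R]_n).
    exact: (cvg_comp _ _ (chart_map_continuous dom1) Ad_chart_cvg).
  apply: cvg_trans h; apply: near_eq_cvg.
  have : \forall g \near (1 : G)%g, chart_dom c g.
    exact: open_nbhs_nbhs (conj (@chart_dom_open _ _ _ c) dom1).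
  by apply: filterS => g dg; rewrite /Ad_chart chart_mapK.
have h : Ad c (g0^-1 * g)%g *m Ad c g0 @[g --> g0] --> 1%:M *m Ad c g0.
  apply: (cvg_mulmx (F := nbhs g0)); last exact: cvg_cst.
  exact: (cvg_comp _ _ to1 A1).
rewrite mul1mx in h; apply: cvg_trans h; apply: near_eq_cvg.
near=> g; apply: (etrans (esym (AdM c1 g0 (g0^-1 * g)%g))).
by rewrite mulgA mulgV mul1g.
Unshelve. all: by end_near. Qed.

Lemma Ad_image_group : compact [set: G] -> compact_group Ad_image.
Proof.
move=> Gc; split.
- by apply: continuous_compact Gc; apply: continuous_subspaceT; exact: Ad_continuous.
- by exists 1%g => //; exact: Ad1.
- by move=> _ _ [g _ <-] [h _ <-]; exists (h * g)%g => //; rewrite AdM.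
- move=> _ [g _ <-]; exists (Ad c g^-1%g); first by exists g^-1%g.
  exact: AdV.
Qed.

Lemma ad_is_linear : linear (ad c).
Proof.
move=> a u v; apply/matrixP => i j.
have E w : ad c w i j = 'D_w (fun u => Ad_chart c u i j) e.
  exact/derive_entry/Ad_chart_derivable.
apply: (etrans (E _)); apply: (etrans (derive_linear a u v (Ad_chart_diff c1 i j))).
apply: (etrans (congr2 (fun x y => a * x + y) (esym (E u)) (esym (E v)))).
by rewrite [RHS]mxE; congr (_ + _); rewrite mxE.
Qed.

Lemma ad_tangent v : exists g, tangent Ad_image g (ad c v).
Proof.
exists (fun s => Ad_chart c (s *: v + e)); split.
  by near=> s; exists (chart_inv c (s *: v + e)).
rewrite -(Ad_chart_e c1); have h : s^-1 *: (Ad_chart c (s *: v + e) - Ad_chart c e) @[s --> 0^'] --> ad c v.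
  exact: Ad_chart_derivable.
have sub : (0 : R)^'+ `=>` (0 : R)^'.
  move=> B hB; rewrite /at_right /within /=.
  have : \forall s \near (0 : R), s != 0 -> B s by exact: hB.
  by apply: filterS => s hs s0; apply: hs; rewrite gt_eqF.
by apply: cvg_trans h; exact: cvg_app sub.
Unshelve. all: by end_near. Qed.

(** The derivative at h = 1 of Ad (g h g^-1) Ad g = Ad g Ad h, in the group
    order of the factors. *)
Lemma Ad_ad g v : ad c v *m Ad c g = Ad c g *m ad c (v *m Ad c g).
Proof.
have dA : differentiable (Ad_chart c) (conj_chart c g e).
  by rewrite (conj_chart_e c1 g); exact/differentiable_mx/Ad_chart_diff.
have dC := conj_chart_diff c1 g.
have dAC : derivable (fun u => Ad_chart c (conj_chart c g u)) e v.
  exact/diff_derivable/(@differentiable_comp _ _ _ _ (conj_chart c g)).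
have dA' : derivable (Ad_chart c) e v by exact: Ad_chart_derivable.
have l := derive_mulmx_l (Ad c g) dAC.
have r := derive_mulmx_r (Ad c g) dA'.
have k := derive_comp v dC dA; rewrite (conj_chart_e c1 g) in k.
have k' := congr1 (fun w => 'D_w (Ad_chart c) e) (AdE c1 g v).
apply: (etrans (esym r)); apply: (etrans _ (congr1 (mulmx (Ad c g)) (etrans k k'))).
apply: (etrans _ l).
apply: near_eq_derive; apply: filterS (conj_dom_near c1 g) => u gu.
set h := chart_inv c u.
have hE : chart_inv c (conj_chart c g u) = (g * h * g^-1)%g by exact: chart_mapK.
apply: (etrans (esym (AdM c1 g h))).
apply: (etrans _ (congr1 (fun k => Ad c g *m Ad c k) (esym hE))).
apply: (etrans _ (AdM c1 (g * h * g^-1)%g g)).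
by congr (Ad c _); rewrite mulgVK.
Qed.

End AdjointGroup.

(** * The theorem *)

Theorem theorem1p1 (R : realType) (n : nat) (G : lieGroupType R n)
    (G_compact : compact [set: G])
    (c : chart R n G) (c1 : chart_at_1 c)
    (G_semisimple : semisimple_bracket (lie_bracket c)) :
  forall x : 'rV[R]_n, exists a b : 'rV[R]_n, x = lie_bracket c a b.
Proof.
pose lin := GRing.isLinear.Build _ _ _ _ _ (ad_is_linear c1).
pose adL : {linear 'rV[R]_n -> 'M[R]_n} := HB.pack (ad c) lin.
have anti x y : x *m ad c y = - (y *m ad c x).
  by rewrite !adE// /lie_bracket /field_bracket opprB.
have center v : ad c v = 0 -> v = 0.
  move=> v0; apply/eqP; rewrite -memv0.
  have br0 u y : y \in <[v]>%VS -> lie_bracket c u y = 0.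
    move=> /vlineP[k ->]; rewrite -adE// anti.
    have -> : ad c (k *: v) = k *: ad c v := linearZ_LR adL k v.
    by rewrite v0 scaler0 mulmx0 oppr0.
  (* The line of a central element is an abelian ideal. *)
  rewrite -(G_semisimple <[v]>%VS) ?memv_line//.
    by move=> u y yv; rewrite br0// mem0v.
  exists 1%N; apply/eqP; rewrite -subv0; apply/span_subvP => w /allpairsP[[u y] /= [ub yb ->]].
  rewrite br0; first exact: mem0v.
  exact: vbasis_mem.
have conj A v : Ad_image c A -> ad c v *m A = A *m ad c (v *m A).
  by case=> g _ <-; exact: Ad_ad.
move=> x; have [a [b xE]] := @compact_commutators R n (Ad_image c) adL
  (Ad_image_group c1 G_compact) anti conj (ad_tangent c1) center x.
by exists a, b; rewrite -adE.
Qed.
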